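(* Let $\Omega=\{(\tau(A),\rho(A)): A\in\mathcal{C}\}$ be the exact $\tau$-$\rho$ region and let $\Omega_\Phi=\{(x,y)\in[-1,1]^2:\ \Phi(x)\le y\le -\Phi(-x)\}$. Then $\Omega=\Omega_\Phi$. Moreover, $\Omega$ is not convex.
   Context: $\mathcal{C}$ denotes the family of all two-dimensional copulas. For $A\in\mathcal{C}$, $\mu_A$ is the corresponding doubly stochastic measure on $[0,1]^2$, determined by $\mu_A([0,x]\times[0,y])=A(x,y)$. Kendall's $\tau$ and Spearman's $\rho$ of $A$ are $$\tau(A)=4\int_{[0,1]^2}A(x,y)\,d\mu_A(x,y)-1,\qquad \rho(A)=12\int_{[0,1]^2}xy\,d\mu_A(x,y)-3.$$ Equivalently, $\Omega$ is the set of all pairs $(\tau(X,Y),\rho(X,Y))$ with $X,Y$ random variables (on a common probability space) having continuous distribution functions, since $\tau(X,Y)$ and $\rho(X,Y)$ depend only on the copula of $(X,Y)$. For an integer $n\ge2$ and $x\in[-1+\frac2n,1]$ let $$\Phi_n(x)=-1-\frac{4}{n^2}+\frac3n+\frac{3x}{n}-\frac{n-2}{\sqrt2\,n^2\sqrt{n-1}}\,(n-2+nx)^{3/2}.$$ The function $\Phi:[-1,1]\to[-1,1]$ is defined by $\Phi(-1)=-1$ and $\Phi(x)=\Phi_n(x)$ if $x\in\left[\frac{2-n}{n},\frac{2-(n-1)}{n-1}\right]$ for some integer $n\ge2$ (the definitions agree at common endpoints). *)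

(* Defs.v *)
From HB Require Import structures.
From mathcomp Require Import all_boot all_order all_algebra.
From mathcomp Require Import all_classical all_reals all_analysis.
From mathcomp Require Import ring lra.

Set Implicit Arguments.
Unset Strict Implicit.
Unset Printing Implicit Defensive.

Import Order.TTheory GRing.Theory Num.Theory.
Import numFieldNormedType.Exports.

Local Open Scope classical_set_scope.
Local Open Scope ring_scope.

(* A copula is a function on [0, 1]^2; it is represented by a total function on
   R^2 whose values outside [0, 1]^2 are unconstrained and never used. *)
Record copula (R : realType) (A : R -> R -> R) : Prop := Copula {
  copulax0 : forall x, 0 <= x <= 1 -> A x 0 = 0 ;
  copula0y : forall y, 0 <= y <= 1 -> A 0 y = 0 ;
  copulax1 : forall x, 0 <= x <= 1 -> A x 1 = x ;
  copula1y : forall y, 0 <= y <= 1 -> A 1 y = y ;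
  copula_2increasing : forall x1 x2 y1 y2,
    0 <= x1 -> x1 <= x2 -> x2 <= 1 -> 0 <= y1 -> y1 <= y2 -> y2 <= 1 ->
    0 <= A x2 y2 - A x2 y1 - A x1 y2 + A x1 y1
}.

Notation plane R := (measurableTypeR R * measurableTypeR R)%type.

Definition unit_square {R : realType} : set (plane R) :=
  `[0, 1]%classic `*` `[0, 1]%classic.

(* [copula_measure A mu] states that mu is the measure mu_A. The value at
   (1, 1) gives mu full mass on the unit square, and the rectangles [0, x] x
   [0, y] form a pi-system, so for each copula A there is exactly one such mu
   (as a function on Borel sets). *)
Definition copula_measure (R : realType) (A : R -> R -> R)
    (mu : probability (plane R) R) :=
  forall x y : R, 0 <= x <= 1 -> 0 <= y <= 1 ->
    mu (`[0, x]%classic `*` `[0, y]%classic) = (A x y)%:E.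

Definition kendall_tau (R : realType) (A : R -> R -> R)
    (mu : probability (plane R) R) : R :=
  4 * (\int[mu]_(z in unit_square) A z.1 z.2) - 1.

Definition spearman_rho (R : realType) (mu : probability (plane R) R) : R :=
  12 * (\int[mu]_(z in unit_square) (z.1 * z.2)) - 3.

Definition tau_rho_region (R : realType) : set (R^o * R^o) :=
  [set p | exists (A : R -> R -> R) (mu : probability (plane R) R),
    [/\ copula A, copula_measure A mu,
        p.1 = kendall_tau A mu & p.2 = spearman_rho mu]].
Arguments tau_rho_region R : clear implicits.

Definition Phi_ {R : realType} (n : nat) (x : R) : R :=
  - 1 - 4 / n%:R ^+ 2 + 3 / n%:R + 3 * x / n%:R
  - (n%:R - 2) / (Num.sqrt 2 * n%:R ^+ 2 * Num.sqrt (n%:R - 1))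
    * (n%:R - 2 + n%:R * x) `^ (3 / 2).

Definition Phi_index {R : realType} (x : R) : set nat :=
  [set n | (2 <= n)%N /\
    (2 - n%:R) / n%:R <= x <= (2 - (n%:R - 1)) / (n%:R - 1)].

(* Only meaningful on [-1, 1]: see [Phi_index_nonempty] and [PhiE] below for
   the fact that the choice of n exists and is irrelevant. *)
Definition Phi {R : realType} (x : R) : R :=
  if x == - 1 then - 1 else Phi_ (xget 2%N (Phi_index x)) x.

Definition Phi_region (R : realType) : set (R^o * R^o) :=
  [set p | [/\ - 1 <= p.1 <= 1, - 1 <= p.2 <= 1 &
               Phi p.1 <= p.2 <= - Phi (- p.1)]].
Arguments Phi_region R : clear implicits.

Lemma Phi_index_nonempty (R : realType) (x : R) :
  - 1 < x <= 1 -> exists n, Phi_index x n.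
Proof.
move=> /andP[x1 x2].
have ex : exists n, (2 <= n)%N && ((2 - n%:R) / n%:R <= x).
  have [k kx] : exists k : nat, 2 / (x + 1) <= k%:R.
    by exists (Num.bound (2 / (x + 1))); apply/ltW/archi_boundP;
      rewrite divr_ge0//; lra.
  exists k.+2 => /=; rewrite ler_pdivrMr ?ltr0n//.
  move: kx; rewrite ler_pdivrMr; last by lra.
  rewrite -(addn2 k) natrD; move: (ler0n R k); nra.
case: (ex_minnP ex) => n /andP[n2 nx] nmin.
exists n; split=> //; apply/andP; split=> //.
move: n2 nmin nx; case: n => [|[|[|n]]]// _ nmin _; first by rewrite ler_pdivlMr; lra.
rewrite [n.+3%:R - 1](_ : _ = n.+2%:R :> R); last by rewrite -(addn1 n.+2) natrD addrK.
by case: (leP x _) => // /ltW h; have := nmin n.+2 h; rewrite ltnn.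
Qed.

Lemma Phi_endpoint (R : realType) (n : nat) (x : R) : (2 <= n)%N ->
  x = (2 - n%:R) / n%:R -> Phi_ n x = Phi_ n.+1 x.
Proof.
move=> n2 xE.
have ge2 : 2 <= n%:R :> R by rewrite (ler_nat R 2).
have n0 : n%:R != 0 :> R by lra.
have n1 : n%:R + 1 != 0 :> R by lra.
rewrite /Phi_ -(addn1 n) natrD.
have -> : n%:R - 2 + n%:R * x = 0 by rewrite xE; field.
have -> : n%:R + 1 - 2 + (n%:R + 1) * x = 2 / n%:R by rewrite xE; field.
rewrite powR0 ?mulr0 ?subr0; last by lra.
have -> : (2 / n%:R : R) `^ (3 / 2) = 2 / n%:R * (Num.sqrt 2 / Num.sqrt n%:R).
  have h : 0 < 2 / n%:R :> R by rewrite divr_gt0//; lra.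
  rewrite (_ : 3 / 2 = 1 + 2^-1); last by field.
  rewrite powRD; last by rewrite (gt_eqF h) implybT.
  rewrite powRr1 ?ltW// powR12_sqrt ?ltW// sqrtrM ?ler0n// sqrtrV//.
rewrite [n%:R + 1 - 1](_ : _ = n%:R); last by ring.
set s := Num.sqrt 2; set t := Num.sqrt n%:R.
have s0 : s != 0 by rewrite sqrtr_eq0; lra.
have t0 : t != 0 by rewrite sqrtr_eq0 -ltNge; lra.
have tt : t ^+ 2 = n%:R by rewrite sqr_sqrtr; lra.
rewrite [(n%:R + 1 - 2) / _ * _](_ : _ = (n%:R - 1) / (n%:R + 1) ^+ 2
    * (2 / n%:R) / t ^+ 2); last by field; apply/and4P.
by rewrite tt xE; field; apply/andP.
Qed.

Lemma PhiE (R : realType) (n : nat) (x : R) : Phi_index x n -> Phi x = Phi_ n x.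
Proof.
have wlog_lt m k : Phi_index x m -> Phi_index x k -> (m < k)%N ->
    Phi_ m x = Phi_ k x.
  move=> [m2 /andP[mx _]] [k2 /andP[_ xk]] mk.
  have m2r : 2 <= m%:R :> R by rewrite (ler_nat R 2).
  have mkr : m%:R + 1 <= k%:R :> R by rewrite natr1 ler_nat.
  move: (mx) (xk); rewrite ler_pdivrMr ?ler_pdivlMr; [|lra|lra].
  move=> h1 h2; have km : k%:R = m%:R + 1 :> R by nra.
  have -> : k = m.+1 by apply/eqP; rewrite -(eqr_nat R) -natr1 km.
  apply: Phi_endpoint => //; apply: le_anti; rewrite mx andbT.
  by move: xk; rewrite km [m%:R + 1 - 1](_ : _ = m%:R)//; ring.
move=> xn; rewrite /Phi ifN.
  have := xgetPex 2%N (ex_intro _ n xn); set k := xget _ _ => xk.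
  by case: (ltngtP k n) => [/wlog_lt->//|/wlog_lt->//|->].
case: xn => n2 /andP[+ _]; apply: contraTneq => ->; rewrite -ltNge.
have ge2 : 2 <= n%:R :> R by rewrite (ler_nat R 2).
by rewrite ltr_pdivlMr; lra.
Qed.

(* Main.v *)
Require Import Defs.
From HB Require Import structures.
From mathcomp Require Import all_boot all_order all_algebra.
From mathcomp Require Import all_classical all_reals all_analysis.
From mathcomp Require Import measurable_realfun ring lra.

Set Implicit Arguments.
Unset Strict Implicit.
Unset Printing Implicit Defensive.

Import Order.TTheory GRing.Theory Num.Theory.
Import numFieldNormedType.Exports.

Local Open Scope classical_set_scope.
Local Open Scope ring_scope.

(* Let p = (1 + tau) / 2 and r = (1 + rho) / 2. For three independent points of a
   copula, p is the probability that a pair is concordant, and comparing the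
   frequencies of the six patterns gives 2 r >= 3 p - 1 + t, where t is the
   density of triangles in the graph joining discordant points. This graph has
   edge density 1 - p, so the lower bound for r follows from Razborov's minimal
   triangle density: with k large parts and a smaller one whose squares sum to p,
   r is at least the sum of the cubes of the parts. The triangle density theorem
   is proved for weighted graphs by induction on k: at a minimiser the first
   order conditions determine mass and edge density of every vertex
   neighbourhood, and the case k - 1 applied to a suitable neighbourhood gives the
   bound. The upper bound is the lower one after the reflection y -> 1 - y.
   Conversely, skew sums and reflections of the comonotone copula realise the
   boundary and, by the intermediate value theorem, everything in between. *)

(** * Weighted graphs *)

(** A complete multipartite graph of mass [M] has [M^3 - 3 M Q + 2 S] triangles, where [Q] and [S]
    are the sums of the squares and of the cubes of its parts: this is inclusion-exclusion on
    coinciding parts. The induction has to survive the passage to a neighbourhood. Its mass is not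
    1, it is compared with [k] parts [U] and a remainder that may be negative, and its [Q] exceeds
    the value of that comparison by exactly the supposed deficit of triangles. Hence [density_bound]
    is homogeneous in the mass, puts no sign on [be], and carries a term linear in the excess of
    [Q]. Its slope [3 M / k] is the smallest one on the arc, reached where [be = 0].

    The minimiser is not taken at a fixed edge density. What is minimised is the excess over the
    conjectured curve, on a closed band of densities. Perturbations may then change the density, and
    the slope of the curve plays the role of a Lagrange multiplier. Only the two ends of the band,
    where a perturbation could leave it, need separate arguments. *)

Section TripleSums.
Variables (R : comNzRingType) (I : finType).
Implicit Types F G : I -> I -> I -> R.

Definition sum3 F : R := \sum_i \sum_j \sum_k F i j k.

Lemma eq_sum3 F G : (forall i j k, F i j k = G i j k) -> sum3 F = sum3 G.
Proof.
by move=> e; apply: eq_bigr => i _; apply: eq_bigr => j _; apply: eq_bigr => k _.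
Qed.

Lemma sum3D F G : sum3 (fun i j k => F i j k + G i j k) = sum3 F + sum3 G.
Proof.
rewrite /sum3 -big_split; apply: eq_bigr => i _ /=.
by rewrite -big_split; apply: eq_bigr => j _ /=; rewrite -big_split.
Qed.

Lemma sum3Z c F : sum3 (fun i j k => c * F i j k) = c * sum3 F.
Proof.
rewrite /sum3 mulr_sumr; apply: eq_bigr => i _ /=.
by rewrite mulr_sumr; apply: eq_bigr => j _ /=; rewrite mulr_sumr.
Qed.

Lemma sum3N F : sum3 (fun i j k => - F i j k) = - sum3 F.
Proof. by rewrite -mulN1r -sum3Z; apply: eq_sum3 => *; rewrite mulN1r. Qed.

Lemma sum3_swap12 F : sum3 F = sum3 (fun i j k => F j i k).
Proof. by rewrite /sum3 exchange_big. Qed.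

Lemma sum3_swap23 F : sum3 F = sum3 (fun i j k => F i k j).
Proof. by rewrite /sum3; apply: eq_bigr => i _; rewrite exchange_big. Qed.

Lemma sum3_rot F : sum3 F = sum3 (fun i j k => F j k i).
Proof. by rewrite sum3_swap23 sum3_swap12. Qed.

End TripleSums.

Section WeightedGraphs.
Variables (R : realType) (I : finType).
Implicit Types (u w n : I -> R) (a b : I -> I -> R).

Definition edges u a : R := \sum_i \sum_j u i * u j * a i j.

Definition triangles u a : R :=
  sum3 (fun i j k => u i * u j * u k * (a i j * a j k * a i k)).

Definition degree u a i : R := \sum_j u j * a i j.

Definition codegree u a i j : R := \sum_k u k * (a i k * a j k).

Definition link_edges u a i : R :=
  \sum_j \sum_k u j * u k * (a i j * a j k * a i k).

(** Fractional adjacencies make the graphs of mass 1 a compact family in which edge weights can be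
    lowered continuously. Loops are allowed. *)
Definition wgraph u a :=
  [/\ forall i, 0 <= u i, forall i j, 0 <= a i j <= 1 & forall i j, a i j = a j i].

Lemma sum_degree u w a : \sum_i w i * degree u a i = \sum_i \sum_j w i * u j * a i j.
Proof.
by apply: eq_bigr => i _; rewrite mulr_sumr; apply: eq_bigr => j _; rewrite mulrA.
Qed.

Lemma sum_link_edges u w a : \sum_i w i * link_edges u a i =
  sum3 (fun i j k => w i * u j * u k * (a i j * a j k * a i k)).
Proof.
apply: eq_bigr => i _; rewrite mulr_sumr; apply: eq_bigr => j _.
by rewrite mulr_sumr; apply: eq_bigr => k _; rewrite !mulrA.
Qed.

Lemma sum_codegree u a b : \sum_i \sum_j u i * u j * b i j * codegree u a i j =
  sum3 (fun i j k => u i * u j * u k * (b i j * a j k * a i k)).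
Proof.
apply: eq_bigr => i _; apply: eq_bigr => j _; rewrite mulr_sumr.
by apply: eq_bigr => k _; ring.
Qed.

Lemma edges_degree u a : edges u a = \sum_i u i * degree u a i.
Proof. by rewrite sum_degree. Qed.

Lemma triangles_link u a : triangles u a = \sum_i u i * link_edges u a i.
Proof. by rewrite sum_link_edges. Qed.

(** Exact expansions along a line of vertex weights, and in [edgesB] and [trianglesB] along a line
    of edge weights. The coefficients of [h] become the first order conditions at a minimiser. *)
Lemma edgesD u w a h : (forall i j, a i j = a j i) ->
  edges (fun i => u i + h * w i) a =
  edges u a + h * (2 * \sum_i w i * degree u a i) + h ^+ 2 * edges w a.
Proof.
move=> asym; rewrite sum_degree mulr2n mulrDl mul1r.
rewrite {2}exchange_big /edges /= !mulrDr !mulr_sumr -!big_split /=.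
apply: eq_bigr => i _; rewrite !mulr_sumr -!big_split /=.
by apply: eq_bigr => j _; rewrite (asym j i); ring.
Qed.

Lemma trianglesD u w a h : (forall i j, a i j = a j i) ->
  triangles (fun i => u i + h * w i) a =
  triangles u a + h * (3 * \sum_i w i * link_edges u a i) +
  h ^+ 2 * (3 * \sum_i u i * link_edges w a i) + h ^+ 3 * triangles w a.
Proof.
move=> asym; rewrite !sum_link_edges /triangles.
set T := fun (x y z : I -> R) i j k => x i * y j * z k * (a i j * a j k * a i k).
have rot x y z : sum3 (T x y z) = sum3 (T z x y).
  by rewrite sum3_rot; apply: eq_sum3 => i j k; rewrite /T (asym j i) (asym k i); ring.
rewrite [LHS](_ : _ = sum3 (fun i j k => T u u u i j k +
  (h * (T w u u i j k + (T u w u i j k + T u u w i j k)) +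
  (h ^+ 2 * (T u w w i j k + (T w u w i j k + T w w u i j k)) +
   h ^+ 3 * T w w w i j k)))); last by apply: eq_sum3 => i j k; rewrite /T; ring.
by rewrite !(sum3D, sum3Z) (rot u w u) (rot u u w) (rot w u w) (rot w w u); ring.
Qed.

Lemma edgesB u a b h : edges u (fun i j => a i j - h * b i j) =
  edges u a - h * edges u b.
Proof.
rewrite /edges mulr_sumr -sumrB; apply: eq_bigr => i _.
by rewrite mulr_sumr -sumrB; apply: eq_bigr => j _; ring.
Qed.

Lemma trianglesB u a b h : (forall i j, a i j = a j i) ->
  (forall i j, b i j = b j i) ->
  triangles u (fun i j => a i j - h * b i j) =
  triangles u a + h * (- 3 * \sum_i \sum_j u i * u j * b i j * codegree u a i j) +
  h ^+ 2 * (3 * \sum_i \sum_j u i * u j * a i j * codegree u b i j) +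
  h ^+ 3 * - triangles u b.
Proof.
move=> asym bsym; rewrite !sum_codegree /triangles.
set T := fun (x y z : I -> I -> R) i j k =>
  u i * u j * u k * (x i j * y j k * z i k).
have Tab x y z : (forall i j, x i j = x j i) -> (forall i j, y i j = y j i) ->
  (forall i j, z i j = z j i) -> sum3 (T x y z) = sum3 (T z x y).
  move=> xs ys zs; rewrite sum3_rot; apply: eq_sum3 => i j k.
  by rewrite /T (zs j i) (ys k i); ring.
rewrite [LHS](_ : _ = sum3 (fun i j k => T a a a i j k +
  (- h * (T b a a i j k + (T a b a i j k + T a a b i j k)) +
  (h ^+ 2 * (T a b b i j k + (T b a b i j k + T b b a i j k)) +
   - h ^+ 3 * T b b b i j k)))); last by apply: eq_sum3 => i j k; rewrite /T; ring.
rewrite !(sum3D, sum3Z) (Tab a b a)// (Tab a a b)// (Tab b a b)// (Tab b b a)//.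
by ring.
Qed.

End WeightedGraphs.

(** * Goodman's inequality and the neighbourhood of a vertex *)

Section CliqueDensity.
Variables (R : realType) (I : finType).
Implicit Types (u : I -> R) (a b : I -> I -> R).

Lemma sum_ge0_le0 u (f : I -> R) : (forall i, 0 <= u i) -> 0 < \sum_i u i ->
  \sum_i u i * f i <= 0 -> exists2 i, 0 < u i & f i <= 0.
Proof.
move=> u0 us uf; apply/not_exists2P => h.
have f0 i : 0 <= u i * f i.
  have := u0 i; rewrite le_eqVlt => /predU1P[<-|ui]; first by rewrite mul0r.
  by case: (h i) => // /negP; rewrite -ltNge => /ltW ?; rewrite mulr_ge0.
have uf0 : \sum_i u i * f i = 0 by apply: le_anti; rewrite uf sumr_ge0.
suff u00 : \sum_i u i = 0 by rewrite u00 ltxx in us.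
apply: big1 => i _; apply/eqP; have := u0 i; rewrite le_eqVlt eq_sym => /orP[//|ui].
have fi0 : u i * f i = 0 by apply: (psumr_eq0P _ uf0) => // ? _; exact: f0.
by case: (h i) => // /negP; rewrite -ltNge => fi; have := mulr_gt0 ui fi; rewrite fi0 ltxx.
Qed.

(** In total mass 1 two neighbourhoods overlap in at least the sum of their degrees minus 1.
    Summation over the edges gives twice the second moment of the degree minus [E], and the variance
    of the degree is nonnegative. *)
Lemma goodman u a : wgraph u a -> \sum_i u i = 1 ->
  2 * edges u a ^+ 2 - edges u a <= triangles u a.
Proof.
move=> [u0 a01 asym] u1; set E := edges u a.
have -> : triangles u a = \sum_i \sum_j u i * u j * a i j * codegree u a i j.
  by rewrite sum_codegree.
have cE i j : degree u a i + degree u a j - 1 <= codegree u a i j.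
  rewrite -u1 -subr_ge0 /codegree /degree -big_split -!sumrB /=.
  apply: sumr_ge0 => k _.
  rewrite [leRHS](_ : _ = u k * ((1 - a i k) * (1 - a j k))); last by ring.
  by rewrite mulr_ge0// mulr_ge0// subr_ge0; case/andP: (a01 i k); case/andP: (a01 j k).
have sE : \sum_i \sum_j u i * u j * a i j * (degree u a i + degree u a j - 1) =
    2 * (\sum_i u i * degree u a i ^+ 2) - E.
  have e1 : \sum_i \sum_j u i * u j * a i j * degree u a i =
      \sum_i u i * degree u a i ^+ 2.
    apply: eq_bigr => i _; rewrite expr2 mulrA -mulr_suml; congr (_ * _).
    by rewrite /degree mulr_sumr; apply: eq_bigr => j _; rewrite mulrA.
  have e2 : \sum_i \sum_j u i * u j * a i j * degree u a j =
      \sum_i u i * degree u a i ^+ 2.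
    rewrite -e1 exchange_big; apply: eq_bigr => i _; apply: eq_bigr => j _ /=.
    by rewrite (asym j i); ring.
  rewrite [2 * _](_ : _ = \sum_i u i * degree u a i ^+ 2
    + \sum_i u i * degree u a i ^+ 2); last by ring.
  rewrite -{1}e1 -e2 /E /edges -big_split -sumrB.
  apply: eq_bigr => i _ /=; rewrite -big_split -sumrB; apply: eq_bigr => j _ /=.
  by ring.
have dE : E ^+ 2 <= \sum_i u i * degree u a i ^+ 2.
  rewrite -subr_ge0.
  have -> : \sum_i u i * degree u a i ^+ 2 - E ^+ 2 =
      \sum_i u i * (degree u a i - E) ^+ 2.
    transitivity (\sum_i (u i * degree u a i ^+ 2 - 2 * E * (u i * degree u a i)
       + E ^+ 2 * u i)); last by apply: eq_bigr => i _; ring.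
    rewrite big_split sumrB /= -!mulr_sumr -edges_degree u1 -/E; ring.
  by apply: sumr_ge0 => i _; rewrite mulr_ge0// sqr_ge0.
apply: (@le_trans _ _ (2 * (\sum_i u i * degree u a i ^+ 2) - E)); first by lra.
rewrite -sE; apply: ler_sum => i _; apply: ler_sum => j _.
by apply: ler_wpM2l => //; rewrite !mulr_ge0//; case/andP: (a01 i j).
Qed.

Lemma mass_link u a z : \sum_i u i * a z i = degree u a z.
Proof. by []. Qed.

Lemma edges_link u a z : (forall i j, a i j = a j i) ->
  edges (fun i => u i * a z i) a = link_edges u a z.
Proof.
by move=> asym; apply: eq_bigr => i _; apply: eq_bigr => j _; ring.
Qed.

(* Inclusion-exclusion over the number of vertices of a triangle which are not
   adjacent to z. *)
Lemma triangles_link_le u a z : wgraph u a ->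
  triangles (fun i => u i * a z i) a <= triangles u a
  - 3 * (\sum_i u i * (1 - a z i) * link_edges u a i)
  + 3 * (\sum_i \sum_j u i * u j * ((1 - a z i) * (1 - a z j) * a i j)
           * codegree u a i j).
Proof.
move=> [u0 a01 asym]; rewrite sum_link_edges sum_codegree.
set n := fun i => 1 - a z i.
have n0 i : 0 <= n i by rewrite subr_ge0; case/andP: (a01 z i).
pose F i j k := u i * u j * u k * (a i j * a j k * a i k).
rewrite [X in _ - 3 * X + _](_ : _ = sum3 (fun i j k => n i * F i j k)); last first.
  by apply: eq_sum3 => i j k; rewrite /F /n; ring.
rewrite [X in _ + 3 * X](_ : _ = sum3 (fun i j k => n i * n j * F i j k)); last first.
  by apply: eq_sum3 => i j k; rewrite /F /n; ring.
have rotF i j k : F j k i = F i j k by rewrite /F (asym j i) (asym k i); ring.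
have r1 : sum3 (fun i j k => n j * F i j k) = sum3 (fun i j k => n i * F i j k).
  by rewrite [RHS]sum3_rot; apply: eq_sum3 => i j k; rewrite -(rotF i j k).
have r2 : sum3 (fun i j k => n k * F i j k) = sum3 (fun i j k => n i * F i j k).
  by rewrite [LHS]sum3_rot; apply: eq_sum3 => i j k; rewrite -(rotF i j k).
have r3 : sum3 (fun i j k => n j * n k * F i j k) = sum3 (fun i j k => n i * n j * F i j k).
  by rewrite [RHS]sum3_rot; apply: eq_sum3 => i j k; rewrite -(rotF i j k).
have r4 : sum3 (fun i j k => n i * n k * F i j k) = sum3 (fun i j k => n i * n j * F i j k).
  by rewrite [LHS]sum3_rot; apply: eq_sum3 => i j k; rewrite -(rotF i j k); ring.
have -> : triangles (fun i => u i * a z i) a = sum3 (fun i j k => F i j k +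
   (- (n i * F i j k + (n j * F i j k + n k * F i j k)) +
   ((n i * n j * F i j k + (n j * n k * F i j k + n i * n k * F i j k))
    - n i * n j * n k * F i j k))).
  by apply: eq_sum3 => i j k; rewrite /F /n; ring.
rewrite !(sum3D, sum3N) r1 r2 r3 r4.
have : 0 <= sum3 (fun i j k => n i * n j * n k * F i j k).
  apply: sumr_ge0 => i _; apply: sumr_ge0 => j _; apply: sumr_ge0 => k _.
  have a0 i' j' : 0 <= a i' j' by case/andP: (a01 i' j').
  by rewrite /F; repeat (apply: mulr_ge0).
rewrite -[triangles u a]/(sum3 F); lra.
Qed.

End CliqueDensity.

(** * The induction step at a stationary graph *)

Section Induction.
Variables (R : realType) (I : finType).
Implicit Types (u : I -> R) (a b : I -> I -> R).

(* The bound attained by k parts of size al and one of size be; at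
   Q = k al^2 + be^2 its slope in Q is only a lower bound for the true slope. *)
Definition density_bound (k : nat) := forall u a (al be : R),
  wgraph u a -> be <= al -> k%:R * al + be = \sum_i u i ->
  let M := \sum_i u i in let Q := M ^+ 2 - edges u a in
  k%:R * al ^+ 2 + be ^+ 2 <= Q ->
  M ^+ 3 - 3 * M * Q + 2 * (k%:R * al ^+ 3 + be ^+ 3)
    + 3 * M / k%:R * (Q - (k%:R * al ^+ 2 + be ^+ 2)) <= triangles u a.

(** [U] and [V] are the parts of the extremal graph, [x] is the mass not adjacent to a chosen
    vertex, and [Mp], [Ep], [Tp] are mass, edges and triangles of its neighbourhood. If [T] falls
    short of the extremal value by [de], the neighbourhood has slack exactly [de] over [K] parts [U]
    and one part [U + V - x]. The lower estimate of [Tp] then exceeds the upper one by a positive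
    multiple of [de]. *)
Lemma link_contradiction (K U V T E x Mp Ep Tp : R) : K = 1 \/ 2 <= K ->
  (K + 1) * U + V = 1 -> 0 < V -> V < U -> E = 1 - ((K + 1) * U ^+ 2 + V ^+ 2) ->
  Mp = 1 - x -> Ep = 2 * (1 - U - V) * (1 - x) + T - 2 * (1 - U - V) * E ->
  0 <= Ep ->
  Tp - 3 * (1 - U - V) * Ep <=
    T * (1 - 3 * x) - 3 * (1 - U - V) * E * (1 - 2 * x) ->
  (K * U ^+ 2 + (U + V - x) ^+ 2 <= Mp ^+ 2 - Ep ->
   Mp ^+ 3 - 3 * Mp * (Mp ^+ 2 - Ep) + 2 * (K * U ^+ 3 + (U + V - x) ^+ 3)
    + 3 * Mp / K * (Mp ^+ 2 - Ep - (K * U ^+ 2 + (U + V - x) ^+ 2)) <= Tp) ->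
  1 - 3 * (1 - E) + 2 * ((K + 1) * U ^+ 3 + V ^+ 3) <= T.
Proof.
move=> K12 KUV V0 VU EE; set kap := 1 - U - V; set s := U + V => -> EpE Ep0 h1 h3; rewrite leNgt; apply/negP => TT.
have K0 : 0 < K by case: K12 => [->|]; lra.
have VE : V = 1 - (K + 1) * U by lra.
set T0 := 1 - 3 * (1 - E) + _ in TT.
pose de := T0 - T; have de0 : 0 < de by rewrite subr_gt0.
have TE : T = T0 - de by rewrite /de; ring.
have QE : (1 - x) ^+ 2 - Ep = K * U ^+ 2 + (s - x) ^+ 2 + de.
  by rewrite EpE TE /T0 EE /s /kap VE; ring.
move: h3 => /=; rewrite QE => /(_ _)/wrap[]; first by lra.
set c := 3 * (1 - x) / K => h3.
have h5 : de * (3 * kap - 2 + c) <= 0.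
  suff : de * (3 * kap - 2 + c) =
    ((1 - x) ^+ 3 - 3 * (1 - x) * (K * U ^+ 2 + (s - x) ^+ 2 + de) +
     2 * (K * U ^+ 3 + (s - x) ^+ 3) +
     c * (K * U ^+ 2 + (s - x) ^+ 2 + de - (K * U ^+ 2 + (s - x) ^+ 2))
     - 3 * kap * Ep) - (T * (1 - 3 * x) - 3 * kap * E * (1 - 2 * x)) by lra.
  rewrite EpE TE /T0 EE /s /kap VE; ring.
have kap0 : 0 < kap by rewrite /kap; nra.
(* [Ep >= 0] bounds [x] from above, hence the slope [c] from below. *)
have h4 : (K + 1) * U <= 2 * (1 - x).
  have : 0 <= kap * (2 * (1 - x) - (K + 1) * U) - de.
    suff <- : Ep = kap * (2 * (1 - x) - (K + 1) * U) - de by [].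
    by rewrite EpE TE /T0 EE /s /kap VE; ring.
  move=> h; rewrite -subr_ge0 -(pmulr_rge0 _ kap0); lra.
suff : 0 < 3 * kap - 2 + c by move=> h6; have := mulr_gt0 de0 h6; lra.
have h6 : 3 * (K + 1) * U / (2 * K) <= c.
  rewrite /c ler_pdivrMr; last by lra.
  rewrite [leRHS](_ : _ = 6 * (1 - x)); first by lra.
  by field; lra.
suff : 0 < 3 * kap - 2 + 3 * (K + 1) * U / (2 * K) by lra.
rewrite [X in 0 < X](_ : _ = (2 * K * (3 * kap - 2) + 3 * (K + 1) * U) / (2 * K)).
  apply: divr_gt0; last by lra.
  rewrite (_ : 3 * kap - 2 = (K - 2) * U - 2 * V); last by rewrite /kap; lra.
  (* The numerator is [(2 K^2 - K + 3) U - 4 K V]. As [V < U], it is positive once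
     [(2 K - 3) (K - 1) >= 0], which fails for [K] strictly between 1 and 3/2; hence the two
     cases. *)
  by case: K12 => [->|K2]; nra.
by field; lra.
Qed.

End Induction.

Section Stationary.
Variables (R : realType) (I : finType).
Implicit Types (u : I -> R) (a b : I -> I -> R).

Lemma sum_nonadjacent_pairs u a z : (forall i j, a i j = a j i) ->
  \sum_i \sum_j u i * u j * ((1 - a z i) * (1 - a z j) * a i j) =
  link_edges u a z - edges u a + 2 * \sum_i u i * (1 - a z i) * degree u a i.
Proof.
move=> asym; pose G i j := u i * u j * a i j.
have e1 : \sum_i u i * (1 - a z i) * degree u a i = \sum_i \sum_j (1 - a z i) * G i j.
  by rewrite sum_degree; apply: eq_bigr => i _; apply: eq_bigr => j _; rewrite /G; ring.
have e2 : \sum_i \sum_j (1 - a z j) * G i j = \sum_i \sum_j (1 - a z i) * G i j.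
  rewrite exchange_big; apply: eq_bigr => i _; apply: eq_bigr => j _ /=.
  by rewrite /G (asym j i); ring.
rewrite [2 * _](_ : _ = \sum_i \sum_j (1 - a z i) * G i j +
  \sum_i \sum_j (1 - a z j) * G i j); last by rewrite e1 e2; ring.
rewrite /link_edges /edges -!big_split -sumrB -big_split; apply: eq_bigr => i _ /=.
rewrite -!big_split -sumrB -big_split; apply: eq_bigr => j _ /=.
by rewrite /G; ring.
Qed.

(* The stationarity conditions are those for moving mass towards a vertex and
   for decreasing edge weights. The density bound with one part less, applied to
   the neighbourhood of a vertex of at most average degree, then excludes that
   the graph has too few triangles. *)
Lemma stationary_bound k u a (U V : R) : (0 < k)%N -> density_bound R I k ->
  wgraph u a -> \sum_i u i = 1 -> k.+1%:R * U + V = 1 -> 0 < V -> V < U ->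
  edges u a = 1 - (k.+1%:R * U ^+ 2 + V ^+ 2) ->
  (forall j, 2 * (1 - U - V) * (degree u a j - edges u a) <=
     link_edges u a j - triangles u a) ->
  (forall b, (forall i j, b i j = b j i) -> (forall i j, 0 <= b i j <= a i j) ->
    \sum_i \sum_j u i * u j * b i j * codegree u a i j <=
    (1 - U - V) * \sum_i \sum_j u i * u j * b i j) ->
  1 - 3 * (1 - edges u a) + 2 * (k.+1%:R * U ^+ 3 + V ^+ 3) <= triangles u a.
Proof.
move=> k0 Ck ug u1 kUV V0 VU EE statu stata; have [u0 a01 asym] := ug.
set E := edges u a; set T := triangles u a; set kap := 1 - U - V.
move: kUV EE; rewrite -(natr1 k) -/E => kUV EE.
have [z uz dz] : exists2 z, 0 < u z & degree u a z - E <= 0.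
  apply: sum_ge0_le0 => //; first by rewrite u1.
  under eq_bigr => i _ do rewrite mulrBr.
  by rewrite sumrB -edges_degree -mulr_suml u1 mul1r subrr.
(* Both sides of [statu] have mean zero under [u], so the inequality is an equality at every vertex
   of positive weight. *)
have support j : u j * link_edges u a j =
    u j * (2 * kap * (degree u a j - E) + T).
  pose f j := u j * (link_edges u a j - T - 2 * kap * (degree u a j - E)).
  suff : f j = 0 by move/eqP; rewrite /f !mulrBr => /eqP; lra.
  have f0 i : true -> 0 <= f i by move=> _; rewrite mulr_ge0// subr_ge0.
  apply: (psumr_eq0P f0) => //.
  transitivity (\sum_i u i * link_edges u a i - T * (\sum_i u i)
    - 2 * kap * (\sum_i u i * degree u a i) + 2 * kap * E * \sum_i u i).
    rewrite [T * _]mulr_sumr [2 * kap * (\sum_i _)]mulr_sumr [2 * kap * E * _]mulr_sumr.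
    by rewrite -!sumrB -big_split; apply: eq_bigr => i _ /=; rewrite /f; ring.
  by rewrite u1 -edges_degree -triangles_link -/E -/T; ring.
have tz : link_edges u a z = 2 * kap * (degree u a z - E) + T.
  by have := support z; apply: mulfI; rewrite gt_eqF.
pose n i := 1 - a z i.
have n01 i : 0 <= n i <= 1.
  by rewrite /n; case/andP: (a01 z i) => *; rewrite subr_ge0 gerBl; apply/andP.
have sn : \sum_i u i * n i = 1 - degree u a z.
  rewrite -u1 -sumrB; apply: eq_bigr => i _; rewrite /n; ring.
set N := \sum_i u i * n i * degree u a i.
have snt : \sum_i u i * n i * link_edges u a i =
    2 * kap * N + (T - 2 * kap * E) * (1 - degree u a z).
  rewrite -sn [2 * kap * _]mulr_sumr [(T - _) * _]mulr_sumr -big_split.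
  apply: eq_bigr => i _ /=.
  by rewrite mulrAC support; ring.
have nna : \sum_i \sum_j u i * u j * (n i * n j * a i j) =
    link_edges u a z - E + 2 * N by exact: sum_nonadjacent_pairs.
(* The edge weights that are lowered are those of pairs outside the neighbourhood of [z]. *)
have nnC := stata (fun i j => n i * n j * a i j) _ _.
have := triangles_link_le z ug; rewrite -/n -/T.
rewrite -/N in snt *; rewrite snt => Tz.
have {}nnC : \sum_i \sum_j u i * u j * (n i * n j * a i j) * codegree u a i j <=
    kap * (link_edges u a z - E + 2 * N).
  rewrite -nna; apply: nnC => i j; first by rewrite asym (mulrC (n i)).
  have /andP[ni0 ni1] := n01 i; have /andP[nj0 nj1] := n01 j.
  have /andP[aij0 aij1] := a01 i j.
  by rewrite !mulr_ge0//= ler_piMl// mulr_ile1.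
have kr : (k%:R : R) = 1 \/ 2 <= k%:R :> R.
  by case: k k0 {Ck kUV EE} => [|[|k]]// _; [left|right; rewrite (ler_nat R 2)].
apply: (@link_contradiction R k%:R U V T E (1 - degree u a z) (degree u a z)
   (edges (fun i => u i * a z i) a) (triangles (fun i => u i * a z i) a)) => //.
- by rewrite subKr.
- by rewrite edges_link// tz subKr -/kap; ring.
- by rewrite edges_link//; apply: sumr_ge0 => i _; apply: sumr_ge0 => j _;
    rewrite !mulr_ge0//; case/andP: (a01 i j); case/andP: (a01 i z);
    case/andP: (a01 z i); case/andP: (a01 z j).
(* The unknown [N] enters through [snt] and through [nnC] with opposite coefficients and cancels,
   leaving only the degree of [z]. *)
- rewrite edges_link// -/kap; rewrite tz in nnC *; lra.
- move=> /=; have := Ck (fun i => u i * a z i) a U (U + V - (1 - degree u a z)).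
  rewrite mass_link; apply.
  + split=> // i; rewrite mulr_ge0//; by case/andP: (a01 z i).
  (* The condition [be <= al] reads [V <= 1 - degree u a z]. It holds because [z] has at most
     average degree and [V <= (k + 1) U^2 + V^2 = 1 - E]. *)
  + have VV : V * ((k%:R + 1) * U + V) = V by rewrite kUV mulr1.
    have : 0 <= (k%:R + 1) * (U * (U - V)).
      by rewrite mulr_ge0 ?addr_ge0// mulr_ge0//; lra.
    by move: dz; rewrite EE; lra.
  + lra.
Qed.

End Stationary.

(** * The extremal curve and first order conditions *)

Section FirstOrder.
Variable R : realType.
Implicit Types (Q E T : R).

(** The difference [al - be] when [k] parts [al] and one part [be] have total 1 and squares of sum
    [Q]. In terms of it, [part_cubes] is the sum of the cubes. *)
Definition part_gap (k : nat) Q : R := Num.sqrt ((k.+1%:R * Q - 1) / k%:R).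

Definition part_cubes (k : nat) Q : R :=
  (1 + 3 * k%:R * part_gap k Q ^+ 2 - k%:R * (k%:R - 1) * part_gap k Q ^+ 3)
  / k.+1%:R ^+ 2.

(** This is [al + be], two thirds of the derivative of [part_cubes k] in [Q]. *)
Definition pair_parts (k : nat) Q : R := (2 - (k%:R - 1) * part_gap k Q) / k.+1%:R.

Lemma part_gap_sqr k Q : (0 < k)%N -> k.+1%:R^-1 <= Q ->
  part_gap k Q ^+ 2 = (k.+1%:R * Q - 1) / k%:R.
Proof.
move=> k0 kQ; rewrite sqr_sqrtr// divr_ge0// subr_ge0.
by move: kQ; rewrite -[_^-1]mul1r ler_pdivrMr ?ltr0Sn// mulrC.
Qed.

Lemma part_gap_gt0 k Q : (0 < k)%N -> k.+1%:R^-1 < Q -> 0 < part_gap k Q.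
Proof.
move=> k0 kQ; rewrite sqrtr_gt0 divr_gt0 ?ltr0n// subr_gt0.
by move: kQ; rewrite -[_^-1]mul1r ltr_pdivrMr ?ltr0Sn// mulrC.
Qed.

(* y^3 - x^3 - (3/2) x (y^2 - x^2) = (y - x)^2 (y + x/2) *)
Lemma part_cubes_tangent k Q : (0 < k)%N -> k.+1%:R^-1 < Q ->
  exists2 C, 0 <= C & forall Q', k.+1%:R^-1 <= Q' ->
  part_cubes k Q + 3 / 2 * pair_parts k Q * (Q' - Q) - C * (Q' - Q) ^+ 2
    <= part_cubes k Q'.
Proof.
move=> k0 kQ; have x0 := part_gap_gt0 k0 kQ.
have xE := part_gap_sqr k0 (ltW kQ); set x := part_gap k Q in x0 xE.
have k1 : 1 <= k%:R :> R by rewrite (ler_nat R 1).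
exists ((k%:R - 1) / (k%:R * x)).
  by rewrite divr_ge0 ?subr_ge0// mulr_ge0// ltW.
move=> Q' kQ'; have yE := part_gap_sqr k0 kQ'; have y0 := sqrtr_ge0 ((k.+1%:R * Q' - 1) / k%:R).
rewrite -/(part_gap k Q') in y0.
rewrite /part_cubes /pair_parts -/x; set y := part_gap k Q' in y0 yE *.
have kS : k.+1%:R = k%:R + 1 :> R by rewrite natr1.
rewrite kS in xE yE *; set K : R := k%:R in k1 kS xE yE *.
have K1 : K + 1 != 0 by lra.
have K0 : K != 0 by lra.
have dQ : Q' - Q = K / (K + 1) * (y ^+ 2 - x ^+ 2).
  by rewrite xE yE; field; apply/andP.
rewrite dQ -subr_ge0.
rewrite [leRHS](_ : _ = K * (K - 1) / (K + 1) ^+ 2 *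
   ((y ^+ 2 - x ^+ 2) ^+ 2 / x - (y - x) ^+ 2 * (y + x / 2))); last first.
  by field; apply/and3P; split=> //; rewrite gt_eqF.
rewrite mulr_ge0//; first by rewrite divr_ge0 ?sqr_ge0// mulr_ge0; lra.
rewrite [leRHS](_ : _ = (y - x) ^+ 2 / x * ((y + x) ^+ 2 - x * (y + x / 2))); last first.
  by field; rewrite gt_eqF.
rewrite mulr_ge0// ?divr_ge0 ?sqr_ge0//; first exact: ltW.
by rewrite subr_ge0; nra.
Qed.

(** The excess over the curve cannot decrease when leaving a minimum, and [3 (1 - pair_parts)] is
    the slope of the curve in the edge density. The quadratic minorant of [part_cubes_tangent]
    replaces differentiation: it makes the error of order [h^2]. *)
Lemma first_order (k : nat) (lo hi T T1 T2 T3 E E1 E2 : R) : (0 < k)%N ->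
  k.+1%:R^-1 <= lo -> lo < 1 - E -> 1 - E < hi ->
  (forall h, 0 <= h <= 1 -> let E' := E + h * E1 + h ^+ 2 * E2 in
     lo <= 1 - E' <= hi ->
     T - (3 * E + 2 * part_cubes k (1 - E)) <=
     T + h * T1 + h ^+ 2 * T2 + h ^+ 3 * T3
     - (3 * E' + 2 * part_cubes k (1 - E'))) ->
  3 * (1 - pair_parts k (1 - E)) * E1 <= T1.
Proof.
move=> k0 klo loE Ehi hmin.
have [C C0 tan] := part_cubes_tangent k0 (le_lt_trans klo loE).
set s := pair_parts k (1 - E) in tan *.
rewrite leNgt; apply/negP => D0; set D := 3 * (1 - s) * E1 - T1.
have {D0} D0 : 0 < D by rewrite subr_gt0.
(* [A] bounds the change of [E] per unit of [h], and [B] the coefficient of all terms of order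
   [h^2]. The chosen [h] stays in the band and keeps [h * B] below [D]. *)
pose A := `|E1| + `|E2| + 1; have A0 : 0 < A by rewrite ltr_wpDl// addr_ge0.
pose ep := Num.min (1 - E - lo) (hi - (1 - E)).
have ep0 : 0 < ep by rewrite lt_min !subr_gt0 loE.
pose B := `|T2| + `|T3| + `|3 * (1 - s) * E2| + 2 * C * A ^+ 2 + 1.
have B0 : 0 < B by rewrite ltr_wpDl// !addr_ge0// mulr_ge0// ?sqr_ge0// mulr_ge0.
pose h := Num.min 1 (Num.min (ep / A) (D / (2 * B))).
have h0 : 0 < h by rewrite !lt_min ltr01 !divr_gt0//= mulr_gt0.
have h1 : h <= 1 by rewrite ge_min lexx.
have hA : h * A <= ep by rewrite -ler_pdivlMr// !ge_min lexx orbT.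
have hB : h * B <= D / 2.
  rewrite -ler_pdivlMr// !ge_min [D / 2 / B](_ : _ = D / (2 * B)) ?lexx ?orbT//.
  by field; rewrite gt_eqF.
have hh : h ^+ 2 <= h by rewrite expr2 ger_pMr.
have sq2 : 0 <= h ^+ 2 by rewrite sqr_ge0.
pose dE := E1 + h * E2.
have dEA : `|dE| <= A.
  rewrite /dE (le_trans (ler_normD _ _))// /A -addrA lerD// normrM.
  by rewrite (ger0_norm (ltW h0)) ler_wpDr// ler_piMl.
have hdE : `|h * dE| <= ep by rewrite normrM (ger0_norm (ltW h0)) (le_trans _ hA)// ler_wpM2l// ltW.
have := hmin h; rewrite h1 ltW//= [E + _ + _](_ : _ = E + h * dE); last by rewrite /dE; ring.
have inrange : lo <= 1 - (E + h * dE) <= hi.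
  move: hdE; rewrite ler_norml /ep => /andP[]; rewrite lerNl le_min le_min.
  by move=> /andP[_ ?] /andP[? _]; apply/andP; split; lra.
move=> /(_ isT inrange); have := tan (1 - (E + h * dE)).
rewrite (le_trans klo); last by case/andP: inrange.
rewrite [_ - (1 - E)](_ : _ = - (h * dE)); last by ring.
move=> /(_ isT) t1 t2.
have dEA2 : dE ^+ 2 <= A ^+ 2 by rewrite -(ger0_norm (sqr_ge0 dE)) normrX lerXn2r// nnegrE// ltW.
have hT : h * (D - h * B) <= 0.
  have e1 : h ^+ 2 * T2 <= h ^+ 2 * `|T2| by rewrite ler_wpM2l// ler_norm.
  have e2 : h ^+ 3 * T3 <= h ^+ 2 * `|T3|.
    apply: (le_trans (ler_norm _)); rewrite normrM ler_wpM2r//.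
    rewrite (@ger0_norm _ (h ^+ 3)) ?exprn_ge0 ?(ltW h0)//.
    by rewrite (exprSr h 2) ler_piMr.
  have e3 : - (h ^+ 2 * (3 * (1 - s) * E2)) <= h ^+ 2 * `|3 * (1 - s) * E2|.
    by rewrite -mulrN ler_wpM2l// -normrN ler_norm.
  have e4 : 2 * C * (h * dE) ^+ 2 <= h ^+ 2 * (2 * C * A ^+ 2).
    rewrite exprMn mulrCA ler_wpM2l// ler_wpM2l// mulr_ge0//.
  have -> : h * (D - h * B) = h * D - (h ^+ 2 * `|T2| + h ^+ 2 * `|T3|
     + h ^+ 2 * `|3 * (1 - s) * E2| + h ^+ 2 * (2 * C * A ^+ 2) + h ^+ 2).
    by rewrite /B; ring.
  have : h * D = 3 * (1 - s) * (h * dE) - h ^+ 2 * (3 * (1 - s) * E2) - h * T1.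
    by rewrite /D /dE; ring.
  move: t1; rewrite sqrrN; lra.
have : h * (D - h * B) > 0 by rewrite mulr_gt0// subr_gt0; lra.
lra.
Qed.

End FirstOrder.

(** * Existence of a minimiser by compactness *)

Section Minimizer.
Variables (R : realType) (I : finType).
Implicit Types (u : I -> R) (a : I -> I -> R).

Let D := (I + I * I)%type.
Let wt (v : 'rV[R]_#|{: D}|) i := v ord0 (enum_rank (inl i : D)).
Let adj (v : 'rV[R]_#|{: D}|) i j :=
  (v ord0 (enum_rank (inr (i, j) : D)) + v ord0 (enum_rank (inr (j, i) : D))) / 2.

Lemma continuous_sumr (T : topologicalType) (J : finType) (f : J -> T -> R) :
  (forall j, continuous (f j)) -> continuous (fun x => \sum_j f j x).
Proof.
move=> fc x; rewrite (_ : (fun x => \sum_j f j x) = \sum_j f j); last first.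
  by apply/funext => y; rewrite fct_sumE.
by elim/big_ind : _ => [|g h gc hc|j _]; [exact: cst_continuous|exact: cvgD|exact: fc].
Qed.

Lemma continuous_part_cubes k : continuous (@part_cubes R k).
Proof.
move=> x; have gc : {for x, continuous (@part_gap R k)}.
  rewrite -[@part_gap R k]/(Num.sqrt \o (fun Q : R => (k.+1%:R * Q - 1) / k%:R)).
  apply: continuous_comp; last exact: sqrt_continuous.
    apply: cvgMr_tmp; apply: cvgB; last exact: cvg_cst.
    by apply: cvgMl_tmp; exact: cvg_id.
have gXc n : {for x, continuous (fun Q : R => part_gap k Q ^+ n)}.
  by apply: (@continuous_comp _ _ _ (@part_gap R k) (fun y => y ^+ n) x gc); exact: exprn_continuous.
apply: cvgMr_tmp; apply: cvgB.
  apply: cvgD; first exact: cvg_cst.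
  by apply: cvgMl_tmp; exact: gXc.
by apply: cvgMl_tmp; exact: gXc.
Qed.

Lemma continuous_average (T : topologicalType) (f g : T -> R) :
  continuous f -> continuous g -> continuous (fun x => (f x + g x) / 2).
Proof. by move=> fc gc x; apply: cvgMr_tmp; apply: cvgD; [exact: fc|exact: gc]. Qed.

Lemma compact_level (T : topologicalType) (K : set T) (f g : T -> R) (c lo hi : R) :
  compact K -> continuous f -> continuous g ->
  compact (K `&` (f @^-1` [set x | x = c] `&` g @^-1` `[lo, hi])).
Proof.
move=> cK fc gc; apply: compact_closedI => //; apply: closedI.
  by apply: preimage_closed => // x _; exact: fc.
by apply: preimage_closed => [x _|]; [exact: gc|exact: itv_closed].
Qed.

Section Continuity.
Variables (T : topologicalType) (u : T -> I -> R) (a : T -> I -> I -> R).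
Hypothesis uc : forall i, continuous (u ^~ i).
Hypothesis ac : forall i j, continuous (fun x => a x i j).

Lemma continuous_edges : continuous (fun x => edges (u x) (a x)).
Proof.
apply: continuous_sumr => i; apply: continuous_sumr => j x.
by apply: cvgM; [apply: cvgM; exact: uc|exact: ac].
Qed.

Lemma continuous_triangles : continuous (fun x => triangles (u x) (a x)).
Proof.
apply: continuous_sumr => i; apply: continuous_sumr => j; apply: continuous_sumr => k x.
apply: cvgM; last by apply: cvgM; [apply: cvgM|]; exact: ac.
by apply: cvgM; [apply: cvgM|]; exact: uc.
Qed.

Lemma continuous_excess k : continuous (fun x =>
  triangles (u x) (a x)
  - (3 * edges (u x) (a x) + 2 * part_cubes k (1 - edges (u x) (a x)))).
Proof.
move=> x; apply: cvgB; first exact: continuous_triangles.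
apply: cvgD; first by apply: cvgMl_tmp; exact: continuous_edges.
apply: cvgMl_tmp.
apply: (@continuous_comp _ _ _ (fun x => 1 - edges (u x) (a x)) (@part_cubes R k) x).
  by apply: cvgB; [exact: cvg_cst|exact: continuous_edges].
exact: continuous_part_cubes.
Qed.

End Continuity.

(* Weights and adjacency are encoded by a point of a cube, the adjacency being
   symmetrised when it is decoded. *)
Lemma exists_minimizer k (lo hi : R) u0 a0 :
  wgraph u0 a0 -> \sum_i u0 i = 1 -> lo <= 1 - edges u0 a0 <= hi ->
  let F u a := triangles u a - (3 * edges u a + 2 * part_cubes k (1 - edges u a)) in
  exists u a, [/\ wgraph u a, \sum_i u i = 1, lo <= 1 - edges u a <= hi &
    forall u' a', wgraph u' a' -> \sum_i u' i = 1 ->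
      lo <= 1 - edges u' a' <= hi -> F u a <= F u' a'].
Proof.
move=> g0 m0 r0 F.
pose E v := edges (wt v) (adj v); pose S v := \sum_i wt v i.
have wtc i : continuous (fun v => wt v i) by move=> v; exact: coord_continuous.
have adjc i j : continuous (fun v => adj v i j).
  by apply: continuous_average => v; exact: coord_continuous.
have Sc : continuous S by exact: continuous_sumr.
have Ec : continuous E by exact: continuous_edges.
pose K := [set v : 'rV[R]_#|{: D}| | forall i, `[0, 1]%classic (v ord0 i)].
pose A := K `&` (S @^-1` [set x | x = 1] `&` E @^-1` `[1 - hi, 1 - lo]).
have cA : compact A.
  apply: compact_level => //.
  by apply: (@rV_compact R _ (fun _ => `[0, 1]%classic)) => i; exact: segment_compact.
pose enc u a : 'rV[R]_#|{: D}| := \row_d match enum_val d with inl i => u i | inr p => a p.1 p.2 end.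
have wtE u a : wt (enc u a) = u by apply/funext => i; rewrite /wt mxE enum_rankK.
have adjE u a : wgraph u a -> adj (enc u a) = a.
  move=> [_ _ asym]; apply/funext => i; apply/funext => j.
  by rewrite /adj !mxE !enum_rankK /= (asym j i); field.
have AE u a : wgraph u a -> \sum_i u i = 1 -> lo <= 1 - edges u a <= hi -> A (enc u a).
  move=> g m r; split; last first.
    split; first by rewrite /preimage /= /S wtE.
    by rewrite /preimage /= /E wtE adjE// in_itv/=; lra.
  have [u0' a01 asym] := g.
  move=> d; rewrite mxE; case: (enum_val d) => [i|[i j]] /=; rewrite in_itv/=; last exact: a01.
  by rewrite u0'/= -m (bigD1 i)//= lerDl sumr_ge0.
have Fc : continuous (fun v => F (wt v) (adj v)) by exact: continuous_excess.
have [v /set_mem[Kv [Sv Ev]] vmin] := EVT_min_rV (ex_intro _ _ (AE _ _ g0 m0 r0)) cA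
  (continuous_subspaceT Fc).
exists (wt v), (adj v); split => //.
- split => [i|i j|i j].
  + by have := Kv (enum_rank (inl i : D)); rewrite /= in_itv => /andP[].
  + have := Kv (enum_rank (inr (i, j) : D)); have := Kv (enum_rank (inr (j, i) : D)).
    by rewrite /= !in_itv/= /adj => /andP[? ?] /andP[? ?]; lra.
  + by rewrite /adj addrC.
- by move: Ev; rewrite /= in_itv/= -/(E v) => ?; lra.
- move=> u' a' g m r; have := vmin (enc u' a'); rewrite wtE adjE//; apply.
  exact/mem_set/AE.
Qed.

End Minimizer.

(** * The triangle density bound *)

Section DensityBound.
Variables (R : realType) (I : finType).
Implicit Types (u : I -> R) (a : I -> I -> R).

Lemma triangles_ge0 u a : wgraph u a -> 0 <= triangles u a.
Proof.
move=> [u0 a01 _]; apply: sumr_ge0 => i _; apply: sumr_ge0 => j _.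
apply: sumr_ge0 => k _; have a0 i' j' : 0 <= a i' j' by case/andP: (a01 i' j').
by rewrite !mulr_ge0.
Qed.

(** With one large part the bound is identically 0 whenever [al + be = M]. *)
Lemma density_bound1 : density_bound R I 1.
Proof.
move=> u a al be ug _ m /= _; rewrite -m [leLHS](_ : _ = 0) ?triangles_ge0//.
by field.
Qed.

Definition large_part (k : nat) (Q : R) : R := (1 + part_gap k Q) / k.+1%:R.
Definition small_part (k : nat) (Q : R) : R := (1 - k%:R * part_gap k Q) / k.+1%:R.

Lemma sum_parts k (Q : R) : k%:R * large_part k Q + small_part k Q = 1.
Proof.
rewrite /large_part /small_part -(natr1 k); field.
by rewrite natr1 pnatr_eq0.
Qed.

Lemma sum_parts2 k (Q : R) : (0 < k)%N -> k.+1%:R^-1 <= Q ->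
  k%:R * large_part k Q ^+ 2 + small_part k Q ^+ 2 = Q.
Proof.
move=> k0 kQ; have := part_gap_sqr k0 kQ.
rewrite /large_part /small_part; set q := part_gap k Q; rewrite -(natr1 k) => qE.
rewrite (_ : _ + _ = (1 + k%:R * q ^+ 2) / (k%:R + 1)); last first.
  by field; rewrite natr1 pnatr_eq0.
by rewrite qE; field; rewrite natr1 !pnatr_eq0 -!lt0n k0.
Qed.

Lemma sum_parts3 k (Q : R) :
  k%:R * large_part k Q ^+ 3 + small_part k Q ^+ 3 = part_cubes k Q.
Proof.
rewrite /large_part /small_part /part_cubes -(natr1 k); field.
by rewrite natr1 pnatr_eq0.
Qed.

Lemma add_parts k (Q : R) : large_part k Q + small_part k Q = pair_parts k Q.
Proof.
rewrite /large_part /small_part /pair_parts -(natr1 k); field.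
by rewrite natr1 pnatr_eq0.
Qed.

(** The ends of an arc: at gap 0 there are [k + 1] equal parts; at gap [1 / k] the small part is
    empty and [k] equal parts remain. *)
Lemma part_gap_lo k : part_gap k (k.+1%:R^-1 : R) = 0.
Proof. by rewrite /part_gap divff ?pnatr_eq0// subrr mul0r sqrtr0. Qed.

Lemma part_gap_hi k : (0 < k)%N -> part_gap k (k%:R^-1 : R) = k%:R^-1.
Proof.
move=> k0; rewrite /part_gap (_ : _ / _ = k%:R^-1 ^+ 2).
  by rewrite sqrtr_sqr ger0_norm.
by rewrite -natr1; field; rewrite pnatr_eq0 -lt0n.
Qed.

Lemma part_gap_le k (Q : R) : (0 < k)%N -> Q <= k%:R^-1 -> part_gap k Q <= k%:R^-1.
Proof.
move=> k0 Qk; rewrite -[leRHS]part_gap_hi// ler_wsqrtr// ler_pM2r ?invr_gt0 ?ltr0n//.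
by rewrite lerD2r ler_pM2l ?ltr0n.
Qed.

Lemma part_gap_lt k (Q : R) : (0 < k)%N -> Q < k%:R^-1 -> part_gap k Q < k%:R^-1.
Proof.
move=> k0 Qk; rewrite -[ltRHS]part_gap_hi//.
rewrite /part_gap ltr_sqrt; last first.
  rewrite divr_gt0 ?ltr0n// -natr1 mulrDl mul1r divff ?pnatr_eq0 -?lt0n//.
  by rewrite addrAC subrr add0r invr_gt0 ltr0n.
rewrite ltr_pM2r ?invr_gt0 ?ltr0n//.
by rewrite ltrD2r ltr_pM2l ?ltr0n.
Qed.

(** It suffices to treat a minimiser of the excess. At the lower end of the band [k + 2] equal parts
    attain Goodman's bound; at the upper end the hypothesis for [k] with [k + 1] equal parts is
    already sharp. In between, small perturbations stay in the band and the minimiser is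
    stationary. *)
Lemma scallop_bound k u a : (0 < k)%N -> density_bound R I k ->
  wgraph u a -> \sum_i u i = 1 ->
  k.+2%:R^-1 <= 1 - edges u a <= k.+1%:R^-1 ->
  1 - 3 * (1 - edges u a) + 2 * part_cubes k.+1 (1 - edges u a) <= triangles u a.
Proof.
move=> k0 Ck g0 m0 r0.
have [v [b [g m r vmin]]] := exists_minimizer k.+1 g0 m0 r0.
suff h : 1 - 3 * (1 - edges v b) + 2 * part_cubes k.+1 (1 - edges v b) <= triangles v b.
  by have := vmin u a g0 m0 r0; lra.
clear g0 m0 r0; have [v0 b01 bsym] := g.
set Q := 1 - edges v b in r *; set K := k.+1 in r vmin *.
have kS : (K%:R : R) = k%:R + 1 by rewrite natr1.
have kSS : (K.+1%:R : R) = k%:R + 2 by rewrite -natr1 kS; ring.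
have kR0 : 0 < k%:R :> R by rewrite ltr0n.
case/andP: r => r1 r2; move: (r1); rewrite le_eqVlt => /predU1P[Qlo|Qlo].
  have := goodman g m; rewrite /part_cubes -Qlo part_gap_lo.
  rewrite (_ : edges v b = 1 - K.+1%:R^-1); last by rewrite Qlo /Q; ring.
  apply: le_trans; rewrite kSS le_eqVlt; apply/orP; left; apply/eqP; field.
  by rewrite gt_eqF// addr_gt0.
move: (r2); rewrite le_eqVlt => /predU1P[Qhi|Qhi].
  have := Ck v b K%:R^-1 K%:R^-1 g (lexx _); rewrite /= m !expr1n -/Q Qhi kS.
  have -> : part_cubes K (k%:R + 1 : R)^-1 = (k%:R + 1)^-1 ^+ 2.
    rewrite /part_cubes -kS part_gap_hi// kSS kS; field.
    by apply/andP; split; rewrite gt_eqF// addr_gt0.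
  rewrite (_ : k%:R * _ + _ = 1) => [/(_ erefl)|]; last first.
    by field; rewrite gt_eqF// addr_gt0.
  rewrite (_ : k%:R * _ ^+ 2 + _ = (k%:R + 1)^-1) => [/(_ (lexx _))|]; last first.
    by field; rewrite gt_eqF// addr_gt0.
  rewrite (_ : k%:R * _ ^+ 3 + _ = (k%:R + 1)^-1 ^+ 2); last first.
    by field; rewrite gt_eqF// addr_gt0.
  lra.
have q0 : 0 < part_gap K Q by exact: part_gap_gt0.
have q1 : part_gap K Q < K%:R^-1 by exact: part_gap_lt.
rewrite -sum_parts3.
have E_Q : edges v b = 1 - Q by rewrite /Q; ring.
have ls : 1 - large_part K Q - small_part K Q = 1 - pair_parts K Q.
  by rewrite -add_parts; ring.
rewrite /Q; apply: stationary_bound => //; rewrite -/Q ?ls.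
- exact: sum_parts.
- rewrite divr_gt0 ?ltr0n// subr_gt0.
  by move: q1; rewrite -[K%:R^-1]mul1r ltr_pdivlMr ?ltr0n// mulrC.
- rewrite ltr_pM2r ?invr_gt0 ?ltr0n// ltrD2l.
  by rewrite (@lt_trans _ _ 0)// oppr_lt0 mulr_gt0// ltr0n.
- by rewrite sum_parts2// -/Q E_Q.
(* Mass moves to [j] from all vertices in proportion to [v]: the total stays 1, and for [h <= 1] the
   weights are convex combinations. *)
- move=> j; pose w i : R := (i == j)%:R - v i.
  have sw f : \sum_i w i * f i = f j - \sum_i v i * f i.
    under eq_bigr => i _ do rewrite mulrBl.
    rewrite sumrB (bigD1 j)//= eqxx mul1r big1 ?addr0// => i /negPf ->.
    by rewrite mul0r.
  have := @first_order R K K.+1%:R^-1 K%:R^-1 (triangles v b)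
    (3 * \sum_i w i * link_edges v b i) (3 * \sum_i v i * link_edges w b i)
    (triangles w b) (edges v b) (2 * \sum_i w i * degree v b i) (edges w b).
  rewrite -/Q.
  move=> /(_ isT (lexx _) Qlo Qhi)/(_ _)/wrap[]; last by rewrite !sw -edges_degree -triangles_link; lra.
  move=> h /andP[h0 h1] /=.
  rewrite -edgesD// -trianglesD// => r'; apply: vmin r'.
    split=> // i; rewrite /w [leRHS](_ : _ = (1 - h) * v i + h * (i == j)%:R); last by ring.
    by rewrite addr_ge0// mulr_ge0// subr_ge0.
  rewrite big_split/= m -mulr_sumr; under eq_bigr => i _ do rewrite -[w i]mulr1.
  by rewrite sw; under [X in 1 - X]eq_bigr => i _ do rewrite mulr1; rewrite m subrr mulr0 addr0.
- move=> c csym c01.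
  have := @first_order R K K.+1%:R^-1 K%:R^-1 (triangles v b)
    (- 3 * \sum_i \sum_j v i * v j * c i j * codegree v b i j)
    (3 * \sum_i \sum_j v i * v j * b i j * codegree v c i j)
    (- triangles v c) (edges v b) (- edges v c) 0.
  rewrite -/Q => /(_ isT (lexx _) Qlo Qhi)/(_ _)/wrap[]; last first.
    rewrite -/(edges v c); lra.
  move=> h /andP[h0 h1] /=; rewrite mulr0 addr0 mulrN -edgesB => r'.
  rewrite -trianglesB//; apply: vmin r' => //; split => // i j.
    have /andP[ci cb] := c01 i j; have /andP[_ bi] := b01 i j.
    have hc : h * c i j <= b i j by rewrite (le_trans _ cb)// ler_piMl.
    have : 0 <= h * c i j by rewrite mulr_ge0.
    lra.
  by rewrite bsym csym.
Qed.

End DensityBound.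

Section DensityBoundAll.
Variables (R : realType) (I : finType).
Implicit Types (u : I -> R) (a : I -> I -> R).

Lemma edges_scale u a c : edges (fun i => c * u i) a = c ^+ 2 * edges u a.
Proof.
rewrite /edges mulr_sumr; apply: eq_bigr => i _.
by rewrite mulr_sumr; apply: eq_bigr => j _; ring.
Qed.

Lemma triangles_scale u a c : triangles (fun i => c * u i) a = c ^+ 3 * triangles u a.
Proof. by rewrite /triangles -sum3Z; apply: eq_sum3 => i j k; ring. Qed.

(** The line of slope [3 / K] through [(P, 2 S)] passes below the corner [(1 / K, 2 / K^2)] of [K]
    equal parts, and before that corner stays below the arc. The arc has slope [3 (al + be)], which
    is at least [3 / K] while [be >= 0]. *)
Lemma density_bound_step (K Q al be : R) : 2 <= K -> be <= al -> K * al + be = 1 ->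
  let P := K * al ^+ 2 + be ^+ 2 in let S := K * al ^+ 3 + be ^+ 3 in
  2 * S - 3 / K * P <= - K^-1 ^+ 2 /\
  forall q, 0 <= q -> q <= K^-1 -> Q = (1 + K * q ^+ 2) / (K + 1) -> P <= Q ->
  2 * S + 3 / K * (Q - P) <=
  2 * ((1 + 3 * K * q ^+ 2 - K * (K - 1) * q ^+ 3) / (K + 1) ^+ 2).
Proof.
move=> K2 ba KE P S.
have beE : be = 1 - K * al by lra.
have K0 : 0 < K by lra.
split.
  pose y := al - K^-1.
  have alE : al = y + K^-1 by rewrite /y; ring.
  have {}beE : be = - (K * y) by rewrite beE alE; field; lra.
  have yK : 0 <= 2 * K * (K + 1) * y + 3.
    have : - 1 <= K * (K + 1) * y.
      rewrite /y mulrBr (_ : K * (K + 1) / K = K + 1); last by field; lra.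
      by nra.
    lra.
  rewrite -subr_ge0 [leRHS](_ : _ = (K - 1) * y ^+ 2 * (2 * K * (K + 1) * y + 3)).
    by apply: mulr_ge0 => //; apply: mulr_ge0; [lra|exact: sqr_ge0].
  by rewrite /S /P beE alE; field; lra.
move=> q q0 qK QE PQ.
pose p := (K + 1) * al - 1.
have p0 : 0 <= p by rewrite /p; lra.
have alE : al = (1 + p) / (K + 1) by rewrite /p; field; lra.
have {}beE : be = (1 - K * p) / (K + 1) by rewrite beE alE; field; lra.
have PE : P = (1 + K * p ^+ 2) / (K + 1) by rewrite /P beE alE; field; lra.
have pq : p <= q.
  move: PQ; rewrite PE QE ler_pM2r ?invr_gt0; last by lra.
  rewrite lerD2l ler_pM2l// => pq2; rewrite -(@ler_pXn2r _ 2)//.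
have Kq : K * q <= 1 by move: qK; rewrite -[K^-1]mul1r ler_pdivlMr// mulrC.
have Kp : K * p <= 1 by rewrite (le_trans _ Kq)// ler_pM2l.
have h : 2 * K * (q ^+ 2 + q * p + p ^+ 2) <= 3 * (q + p).
  have Kq0 : 0 <= 1 - K * q by rewrite subr_ge0.
  have Kp0 : 0 <= 1 - K * p by rewrite subr_ge0.
  have := mulr_ge0 q0 Kq0; have := mulr_ge0 q0 Kp0.
  by have := mulr_ge0 p0 Kq0; have := mulr_ge0 p0 Kp0; lra.
rewrite -subr_ge0 [leRHS](_ : _ = (K - 1) * (q - p) / (K + 1) ^+ 2 *
  (3 * (q + p) - 2 * K * (q ^+ 2 + q * p + p ^+ 2))).
  have K1 : 0 <= K - 1 by lra.
  apply: mulr_ge0; last by rewrite subr_ge0.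
  by apply: divr_ge0; [apply: mulr_ge0; rewrite // subr_ge0|exact: sqr_ge0].
rewrite /S PE QE beE alE; field; apply/andP; split; lra.
Qed.

(** Beyond the corner of [k + 1] equal parts the bound for [k] started at that corner suffices, as
    its slope [3 / k] exceeds [3 / (k + 1)]. Before the corner the sharp arc does. *)
Lemma density_bound_normalized k u a al be : (0 < k)%N -> density_bound R I k ->
  wgraph u a -> \sum_i u i = 1 -> be <= al -> k.+1%:R * al + be = 1 ->
  let Q := 1 - edges u a in let P := k.+1%:R * al ^+ 2 + be ^+ 2 in P <= Q ->
  1 - 3 * Q + 2 * (k.+1%:R * al ^+ 3 + be ^+ 3) + 3 / k.+1%:R * (Q - P)
  <= triangles u a.
Proof.
move=> k0 Ck ug u1 ba abE Q P PQ.
have k1 : 1 <= k%:R :> R by rewrite (ler_nat R 1).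
have K2 : 2 <= k.+1%:R :> R by rewrite (ler_nat R 2).
have kS : (k.+1%:R : R) = k%:R + 1 by rewrite natr1.
have [h1 h2] := density_bound_step Q K2 ba abE.
have := leP (k.+1%:R^-1) Q => -[Qk|Qk].
  have := Ck u a k.+1%:R^-1 k.+1%:R^-1 ug (lexx _); rewrite /= u1 !expr1n -/Q.
  rewrite (_ : k%:R * _ + _ = 1) => [/(_ erefl)|]; last by rewrite kS; field; lra.
  rewrite (_ : k%:R * _ ^+ 2 + _ = k.+1%:R^-1) => [/(_ Qk)|]; last by rewrite kS; field; lra.
  rewrite (_ : k%:R * _ ^+ 3 + _ = k.+1%:R^-1 ^+ 2); last by rewrite kS; field; lra.
  apply: le_trans.
  have h3 : 3 / k.+1%:R * (Q - k.+1%:R^-1) <= 3 * 1 / k%:R * (Q - k.+1%:R^-1).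
    by rewrite mulr1 ler_wpM2r ?subr_ge0// ler_pM2l// lef_pV2 ?posrE ?ltr0n// ler_nat.
  have : 3 / k.+1%:R * (Q - P) = 3 / k.+1%:R * (Q - k.+1%:R^-1)
      + 3 * k.+1%:R^-1 ^+ 2 - 3 / k.+1%:R * P by field; lra.
  rewrite -/P in h1; move: h1 h3; rewrite mulr1.
  move: (3 / _ * P) (3 / k.+1%:R * (Q - P)) (3 / k.+1%:R * (Q - _)).
  by move: (3 / k%:R * _) (_^-1 ^+ 2) (_ + _ ^+ 3) => *; lra.
(* Cauchy-Schwarz for [k + 2] numbers of sum 1. *)
have Plo : k.+2%:R^-1 <= P.
  rewrite -[leLHS]mul1r ler_pdivrMr ?ltr0Sn// -(natr1 k.+1) -subr_ge0.
  rewrite [leRHS](_ : _ = k.+1%:R * (al - be) ^+ 2); first by rewrite mulr_ge0 ?sqr_ge0.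
  have e1 : 1 = (k.+1%:R * al + be) ^+ 2 by rewrite abE expr1n.
  by rewrite [X in _ - X]e1 /P; ring.
have Qlo := le_trans Plo PQ.
apply: le_trans (scallop_bound k0 Ck ug u1 _); last by rewrite -/Q Qlo ltW.
rewrite -/Q -[leLHS]addrA lerD2l -/P /part_cubes -(natr1 k.+1).
apply: h2 => //; first exact: sqrtr_ge0.
  by rewrite part_gap_le// ltW.
by rewrite part_gap_sqr// -(natr1 k.+1); field; apply/andP; split; lra.
Qed.

Lemma density_bound_all k : (0 < k)%N -> density_bound R I k.
Proof.
elim: k => [//|[_ _|k IH _]]; first exact: density_bound1.
have {}IH := IH isT; set k1 := k.+1 in IH *.
move=> u a al be ug ba abE /=; set M := \sum_i u i in abE *.
set Q := M ^+ 2 - _ => PQ; have [u0 a01 asym] := ug.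
have M0 : 0 <= M by exact: sumr_ge0.
have K0 : 0 < k1.+1%:R :> R by rewrite ltr0Sn.
move: M0; rewrite le_eqVlt => /predU1P[M0|M0].
  have ui0 i : u i = 0 by apply: (psumr_eq0P _ (esym M0)) => // ? _; exact: u0.
  have E0 : edges u a = 0.
    by apply: big1 => i _; apply: big1 => j _; rewrite ui0 !mul0r.
  have Q0 : Q = 0 by rewrite /Q E0 -M0; ring.
  move: PQ; rewrite Q0 => PQ.
  have al0 : al = 0.
    apply/eqP; rewrite -sqrf_eq0 -(mulrI_eq0 _ (lregP (lt0r_neq0 K0))).
    by rewrite -[X in X == _]addr0 eq_le; have := sqr_ge0 be; have := sqr_ge0 al; nra.
  have be0 : be = 0 by move: abE; rewrite al0 -M0; lra.
  rewrite al0 be0 -M0 !expr0n /= !(mulr0, mul0r, addr0, subr0).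
  exact: triangles_ge0.
have M_neq0 : M != 0 by rewrite gt_eqF.
pose v i := M^-1 * u i.
have vg : wgraph v a by split=> // i; rewrite mulr_ge0// invr_ge0 ltW.
have v1 : \sum_i v i = 1 by rewrite -mulr_sumr mulVf.
have := @density_bound_normalized k1 v a (al / M) (be / M) isT IH vg v1.
rewrite ler_pM2r ?invr_gt0// => /(_ ba).
rewrite mulrA -mulrDl abE divff// => /(_ erefl) /=.
rewrite edges_scale triangles_scale.
have -> : 1 - M^-1 ^+ 2 * edges u a = Q / M ^+ 2 by rewrite /Q; field.
have -> : k1.+1%:R * (al / M) ^+ 2 + (be / M) ^+ 2 =
  (k1.+1%:R * al ^+ 2 + be ^+ 2) / M ^+ 2 by field.
rewrite ler_pM2r ?invr_gt0 ?exprn_gt0// => /(_ PQ) h.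
rewrite -(@ler_pM2l _ (M^-1 ^+ 3)) ?exprn_gt0 ?invr_gt0//.
apply: le_trans h; rewrite le_eqVlt; apply/orP; left; apply/eqP.
by field; apply/andP; split=> //; rewrite gt_eqF.
Qed.

End DensityBoundAll.

(** * Discretisation of a copula *)

Section Patterns.

(** Strict in both coordinates: cells in the same row or column of a grid are not joined. *)
Definition discordant (p q : nat * nat) : bool :=
  (p.1 < q.1)%N && (q.2 < p.2)%N || (q.1 < p.1)%N && (p.2 < q.2)%N.

Lemma discordantC p q : discordant p q = discordant q p.
Proof. by rewrite /discordant orbC. Qed.

(** [aij] and [bij] stand for [x_i <= x_j] and [y_i <= y_j]. Totality and transitivity are all that
    matters, so three points, ties included, reduce to a finite check. *)
Lemma pattern_bool (a12 a21 a13 a31 a23 a32 b12 b21 b13 b31 b23 b32 : bool) :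
  let preorder c12 c21 c13 c31 c23 c32 :=
    [&& c12 || c21, c13 || c31, c23 || c32, c12 && c23 ==> c13, c13 && c32 ==> c12,
        c21 && c13 ==> c23, c23 && c31 ==> c21, c31 && c12 ==> c32 & c32 && c21 ==> c31] in
  let d p p' q q' := (~~ p' && ~~ q) || (~~ p && ~~ q') in
  let d12 := d a12 a21 b12 b21 in let d13 := d a13 a31 b13 b31 in
  let d23 := d a23 a32 b23 b32 in
  [&& preorder a12 a21 a13 a31 a23 a32 & preorder b12 b21 b13 b31 b23 b32] ==>
  (4 + d12 * d23 * d13 <= 2 * ((a21 && b31) + (a31 && b21) + ((a12 && b32) + (a32 && b12))
     + ((a13 && b23) + (a23 && b13))) + (d12 + d23 + d13))%N.
Proof.
move: a12 a21 a13 a31 a23 a32 => [] [] [] [] [] [] //=;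
move: b12 b21 b13 b31 b23 b32 => [] [] [] [] [] [] //.
Qed.

Definition below_left (p q r : nat * nat) : bool := (q.1 <= p.1)%N && (r.2 <= p.2)%N.

(* Among three points the quadruples (i, j, k) with x_j <= x_i and y_k <= y_i
   count the patterns 123, 132 and 213 twice. *)
Lemma pattern_count (p1 p2 p3 : nat * nat) :
  (4 + discordant p1 p2 * discordant p2 p3 * discordant p1 p3 <=
   2 * (below_left p1 p2 p3 + below_left p1 p3 p2 + (below_left p2 p1 p3 + below_left p2 p3 p1)
        + (below_left p3 p1 p2 + below_left p3 p2 p1))
   + (discordant p1 p2 + discordant p2 p3 + discordant p1 p3))%N.
Proof.
have dE p q : discordant p q = ~~ (q.1 <= p.1)%N && ~~ (p.2 <= q.2)%N
    || ~~ (p.1 <= q.1)%N && ~~ (q.2 <= p.2)%N by rewrite /discordant !ltnNge.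
case: p1 p2 p3 => [x1 y1] [x2 y2] [x3 y3] /=; rewrite !dE /below_left /=.
have := pattern_bool (x1 <= x2)%N (x2 <= x1)%N (x1 <= x3)%N (x3 <= x1)%N (x2 <= x3)%N (x3 <= x2)%N
  (y1 <= y2)%N (y2 <= y1)%N (y1 <= y3)%N (y3 <= y1)%N (y2 <= y3)%N (y3 <= y2)%N.
move=> /= /implyP; apply.
have pre (z1 z2 z3 : nat) : [&& (z1 <= z2) || (z2 <= z1), (z1 <= z3) || (z3 <= z1),
    (z2 <= z3) || (z3 <= z2), (z1 <= z2) && (z2 <= z3) ==> (z1 <= z3),
    (z1 <= z3) && (z3 <= z2) ==> (z1 <= z2), (z2 <= z1) && (z1 <= z3) ==> (z2 <= z3),
    (z2 <= z3) && (z3 <= z1) ==> (z2 <= z1), (z3 <= z1) && (z1 <= z2) ==> (z3 <= z2)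
    & (z3 <= z2) && (z2 <= z1) ==> (z3 <= z1)]%N.
  rewrite !leq_total /=; do ![apply/andP; split];
    by apply/implyP => /andP[]; exact: leq_trans.
by rewrite !pre.
Qed.

End Patterns.

Section WeightedPoints.
Variables (R : realType) (I : finType) (pt : I -> nat * nat) (w : I -> R).
Hypothesis w0 : forall i, 0 <= w i.
Hypothesis w1 : \sum_i w i = 1.

Definition disc i j : R := (discordant (pt i) (pt j))%:R.

Definition cdfX i : R := \sum_j w j * ((pt j).1 <= (pt i).1)%:R.
Definition cdfY i : R := \sum_j w j * ((pt j).2 <= (pt i).2)%:R.

Lemma wgraph_disc : wgraph w disc.
Proof.
split=> // [i j|i j]; last by rewrite /disc discordantC.
by rewrite /disc ler0n (ler_nat R _ 1) leq_b1.
Qed.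

(** Both sides are averages over three independent points. The six relabellings of a triple have the
    same average, so the right side can be symmetrised and compared termwise by [pattern_count]. *)
Lemma sum_cdf_ge :
  4 - 3 * edges w disc + triangles w disc <= 12 * \sum_i w i * cdfX i * cdfY i.
Proof.
pose W i j k := w i * w j * w k.
pose g i j k : R := (below_left (pt i) (pt j) (pt k))%:R.
have -> : \sum_i w i * cdfX i * cdfY i = sum3 (fun i j k => W i j k * g i j k).
  apply: eq_bigr => i _; rewrite /cdfX mulr_sumr mulr_suml; apply: eq_bigr => j _.
  by rewrite /cdfY mulr_sumr; apply: eq_bigr => k _; rewrite /g /below_left -mulnb natrM /W; ring.
have sW : sum3 W = 1.
  rewrite /sum3 -[RHS]w1; apply: eq_bigr => i _.
  rewrite -[RHS]mulr1 -[in RHS]w1 mulr_sumr; apply: eq_bigr => j _.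
  by rewrite /W -mulr_sumr w1 mulr1.
have sE : sum3 (fun i j k => W i j k * disc i j) = edges w disc.
  by apply: eq_bigr => i _; apply: eq_bigr => j _; rewrite /W -mulr_suml -mulr_sumr w1; ring.
have r12 (f : I -> I -> I -> R) :
    sum3 (fun i j k => W i j k * f j i k) = sum3 (fun i j k => W i j k * f i j k).
  by rewrite sum3_swap12; apply: eq_sum3 => i j k; rewrite /W; ring.
have r23 (f : I -> I -> I -> R) :
    sum3 (fun i j k => W i j k * f i k j) = sum3 (fun i j k => W i j k * f i j k).
  by rewrite sum3_swap23; apply: eq_sum3 => i j k; rewrite /W; ring.
have s6 : 6 * sum3 (fun i j k => W i j k * g i j k) = sum3 (fun i j k => W i j k *
    (g i j k + g i k j + (g j i k + g j k i) + (g k i j + g k j i))).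
  transitivity (sum3 (fun i j k => W i j k * g i j k + (W i j k * g i k j +
    (W i j k * g j i k + (W i j k * g j k i + (W i j k * g k i j + W i j k * g k j i)))))).
    rewrite !sum3D (r23 g) (r12 g) (r12 (fun i j k => g i k j)) (r23 g).
    rewrite (r23 (fun i j k => g j i k)) (r12 g).
    by rewrite (r12 (fun i j k => g k i j)) (r23 (fun i j k => g j i k)) (r12 g); ring.
  by apply: eq_sum3 => i j k; ring.
have -> : 12 * sum3 (fun i j k => W i j k * g i j k) =
  2 * (6 * sum3 (fun i j k => W i j k * g i j k)) by ring.
rewrite s6 -sum3Z.
have -> : 4 - 3 * edges w disc + triangles w disc = sum3 (fun i j k => W i j k *
    (4 - (disc i j + disc j k + disc i k) + disc i j * disc j k * disc i k)).
  transitivity (sum3 (fun i j k => 4 * W i j k + (- (W i j k * disc i j +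
     (W i j k * disc j k + W i j k * disc i k)) +
     w i * w j * w k * (disc i j * disc j k * disc i k)))).
    rewrite !(sum3D, sum3N, sum3Z) sW -/(triangles w disc) sE.
    have e2 : sum3 (fun i j k => W i j k * disc i k) = edges w disc.
      by rewrite (r23 (fun i j k => disc i j)).
    have e3 : sum3 (fun i j k => W i j k * disc j k) = edges w disc.
      by rewrite (r12 (fun i j k => disc i k)).
    by rewrite e2 e3; ring.
  by apply: eq_sum3 => i j k; rewrite /W; ring.
apply: ler_sum => i _; apply: ler_sum => j _; apply: ler_sum => k _.
rewrite mulrCA ler_wpM2l//; first by rewrite /W !mulr_ge0.
have := pattern_count (pt i) (pt j) (pt k).
rewrite -(ler_nat R) !(natrD, natrM) /disc /g; lra.
Qed.

End WeightedPoints.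

(** * Measures with uniform margins and their integrals *)

Section UniformMargins.
Variable R : realType.
Implicit Types (mu : probability (plane R) R) (x y : R) (f : plane R -> R).

Definition box x y : set (plane R) := `[0, x]%classic `*` `[0, y]%classic.

Definition cdf2 mu x y : R := fine (mu (box x y)).

(** Copulas are handled through their measures; [copula_cdf2], [copula_measure_cdf2] and
    [copula_uniform_margins] translate between the two. *)
Definition uniform_margins mu :=
  (forall x, 0 <= x <= 1 -> cdf2 mu x 1 = x) /\
  (forall y, 0 <= y <= 1 -> cdf2 mu 1 y = y).

Definition cell (a b c d : R) : set (plane R) := `]a, b]%classic `*` `]c, d]%classic.

Lemma measurable_box x y : measurable (box x y).
Proof. by apply: measurableX; exact: measurable_itv. Qed.

Lemma measurable_cell a b c d : measurable (cell a b c d).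
Proof. by apply: measurableX; exact: measurable_itv. Qed.

Lemma measurable_unit_square : measurable (@unit_square R).
Proof. exact: measurable_box. Qed.

Lemma prob_fineK mu (A : set (plane R)) : measurable A -> (fine (mu A))%:E = mu A.
Proof. by move=> mA; rewrite fineK// fin_num_measure. Qed.

Lemma prob_ge0 mu (A : set (plane R)) : 0 <= fine (mu A).
Proof. by rewrite fine_ge0. Qed.

Lemma prob_setD mu (A B : set (plane R)) : measurable A -> measurable B ->
  B `<=` A -> fine (mu (A `\` B)) = fine (mu A) - fine (mu B).
Proof.
move=> mA mB BA; rewrite measureD//; last by rewrite ltey_eq fin_num_measure.
by rewrite (setIidr BA) fineB// fin_num_measure.
Qed.

Lemma prob_cell mu a b c d : 0 <= a -> a <= b -> 0 <= c -> c <= d ->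
  fine (mu (cell a b c d)) =
  cdf2 mu b d - cdf2 mu a d - cdf2 mu b c + cdf2 mu a c.
Proof.
move=> a0 ab c0 cd; pose S e : set (plane R) := box b e `\` box a e.
have mS e : measurable (S e) by apply: measurableD; exact: measurable_box.
have boxS e : box a e `<=` box b e.
  move=> [x y] [] /=; rewrite !in_itv/= => /andP[x0 xa] ye.
  by split; rewrite /= in_itv/= ?x0 ?(le_trans xa ab).
have pS e : fine (mu (S e)) = cdf2 mu b e - cdf2 mu a e.
  by rewrite prob_setD//; exact: measurable_box.
have -> : cell a b c d = S d `\` S c.
  apply/seteqP; split => [[x y]|[x y]].
    move=> [] /=; rewrite !in_itv/= => /andP[ax xb] /andP[cy yd]; split.
      split; first by split; rewrite /= in_itv/= ?xb ?yd andbT; lra.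
      by move=> [+ _]; rewrite /= in_itv/= [(x <= a)%R]leNgt ax andbF.
    by move=> [[_ +] _]; rewrite /= in_itv/= [(y <= c)%R]leNgt cy andbF.
  move=> [[[/=]]]; rewrite !in_itv/= => /andP[x0 xb] /andP[y0 yd] nxa nSc.
  have ax : a < x.
    by rewrite ltNge; apply/negP => xa; apply: nxa; split; rewrite /= in_itv/= ?x0 ?y0.
  split; rewrite /= in_itv/= ?ax ?xb ?yd ?andbT//.
  rewrite ltNge; apply/negP => yc; apply: nSc; split.
    by split; rewrite /= in_itv/= ?x0 ?xb ?y0.
  by move=> [+ _]; rewrite /= in_itv/= [(x <= a)%R]leNgt ax andbF.
have SS : S c `<=` S d.
  move=> [x y] [[/=]]; rewrite !in_itv/= => /andP[x0 xb] /andP[y0 yc] h; split.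
    by split; rewrite /= in_itv/= ?x0 ?y0// (le_trans yc).
  move=> [/= hx _]; apply: h; split => //=; rewrite in_itv/= y0//.
by rewrite prob_setD// !pS; ring.
Qed.

Lemma cdf2_ge0 mu x y : 0 <= cdf2 mu x y. Proof. exact: prob_ge0. Qed.

Lemma le_prob mu (A B : set (plane R)) : measurable A -> measurable B ->
  A `<=` B -> fine (mu A) <= fine (mu B).
Proof.
move=> mA mB AB; rewrite fine_le ?fin_num_measure//.
by rewrite le_measure ?inE.
Qed.

Lemma le_cdf2 mu x x' y y' : x <= x' -> y <= y' -> cdf2 mu x y <= cdf2 mu x' y'.
Proof.
move=> xx yy; apply: le_prob; [exact: measurable_box..|].
move=> [a b] [] /=; rewrite !in_itv/= => /andP[a0 ax] /andP[b0 b_y].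
by split; rewrite /= in_itv/= ?a0 ?b0 ?(le_trans ax) ?(le_trans b_y).
Qed.

Section Margins.
Variable mu : probability (plane R) R.
Hypothesis mu_unif : uniform_margins mu.

Lemma cdf2_x1 x : 0 <= x <= 1 -> cdf2 mu x 1 = x. Proof. exact: mu_unif.1. Qed.
Lemma cdf2_1y y : 0 <= y <= 1 -> cdf2 mu 1 y = y. Proof. exact: mu_unif.2. Qed.

Lemma cdf2_lex x y : 0 <= x -> x <= 1 -> y <= 1 -> cdf2 mu x y <= x.
Proof. by move=> x0 x1 y1; rewrite -[leRHS]cdf2_x1 ?x0// le_cdf2. Qed.

Lemma cdf2_ley x y : 0 <= y -> y <= 1 -> x <= 1 -> cdf2 mu x y <= y.
Proof. by move=> y0 y1 x1; rewrite -[leRHS]cdf2_1y ?y0// le_cdf2. Qed.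

Lemma cdf2_x0 x : x <= 1 -> cdf2 mu x 0 = 0.
Proof. by move=> x1; apply: le_anti; rewrite cdf2_ge0 cdf2_ley. Qed.

Lemma cdf2_0y y : y <= 1 -> cdf2 mu 0 y = 0.
Proof. by move=> x1; apply: le_anti; rewrite cdf2_ge0 cdf2_lex. Qed.

Lemma prob_unit_square : fine (mu unit_square) = 1.
Proof. by rewrite -[RHS]cdf2_x1// ler01 lexx. Qed.

Lemma copula_cdf2 : copula (cdf2 mu).
Proof.
split=> [x /andP[_ x1]|y /andP[_ y1]|||x1 x2 y1 y2 x10 x12 x21 y10 y12 y21].
- exact: cdf2_x0.
- exact: cdf2_0y.
- exact: cdf2_x1.
- exact: cdf2_1y.
- by rewrite [leRHS](_ : _ = fine (mu (cell x1 x2 y1 y2))) ?prob_ge0// prob_cell//; ring.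
Qed.

Lemma copula_measure_cdf2 : copula_measure (cdf2 mu) mu.
Proof. by move=> x y _ _; rewrite prob_fineK//; exact: measurable_box. Qed.

End Margins.

Lemma copula_uniform_margins (A : R -> R -> R) mu : copula A ->
  copula_measure A mu -> uniform_margins mu /\
  (forall x y, 0 <= x <= 1 -> 0 <= y <= 1 -> A x y = cdf2 mu x y).
Proof.
move=> cA Amu; have AE x y : 0 <= x <= 1 -> 0 <= y <= 1 -> A x y = cdf2 mu x y.
  by move=> hx hy; rewrite /cdf2 Amu.
have i1 : (0 : R) <= 1 <= (1 : R) by rewrite ler01 /=.
split=> //; split=> z hz.
  by rewrite -(AE z 1 hz i1); exact: (copulax1 cA hz).
by rewrite -(AE 1 z i1 hz); exact: (copula1y cA hz).
Qed.

(** The value at [z] is the measure of the section at [z] of the set of pairs [(z, w)] with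
    [0 <= w <= z] in both coordinates. *)
Lemma measurable_cdf2 mu : measurable_fun setT (fun z : plane R => cdf2 mu z.1 z.2).
Proof.
pose E : set (plane R * plane R) :=
  [set p | 0 <= p.2.1] `&` [set p | p.2.1 <= p.1.1]
  `&` ([set p | 0 <= p.2.2] `&` [set p | p.2.2 <= p.1.2]).
have mle (f g : plane R * plane R -> R) : measurable_fun setT f ->
    measurable_fun setT g -> measurable [set p | f p <= g p].
  by move=> mf mg; rewrite -[X in measurable X]setTI; exact: measurable_fun_le.
have m11 : measurable_fun setT (fun p : plane R * plane R => p.1.1).
  by apply: measurableT_comp => //; exact: measurable_fst.
have m12 : measurable_fun setT (fun p : plane R * plane R => p.1.2).
  by apply: measurableT_comp => //; exact: measurable_snd.
have m21 : measurable_fun setT (fun p : plane R * plane R => p.2.1).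
  by apply: measurableT_comp => //; exact: measurable_fst.
have m22 : measurable_fun setT (fun p : plane R * plane R => p.2.2).
  by apply: measurableT_comp => //; exact: measurable_snd.
have mE : measurable E.
  by apply: measurableI; apply: measurableI; apply: mle => //; exact: measurable_cst.
have -> : (fun z : plane R => cdf2 mu z.1 z.2) = fine \o (mu \o xsection E).
  apply/funext => -[x y]; rewrite /cdf2 /=; congr (fine (mu _)).
  apply/seteqP; split=> -[a b].
    move=> [] /=; rewrite !in_itv/= => /andP[? ?] /andP[? ?].
    by apply/xsectionP; do !split.
  move=> /xsectionP[[? ?] [? ?]]; split; rewrite /= in_itv/=; exact/andP.
exact: (measurableT_comp (fine_measurable measurableT) (measurable_fun_xsection mu mE)).
Qed.

End UniformMargins.

Section Integrals.
Variable R : realType.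
Implicit Types (mu : probability (plane R) R) (f g : plane R -> R).

Definition mean mu f : R := \int[mu]_(z in unit_square) f z.

Lemma unit_integrable mu f : measurable_fun setT f ->
  (forall z, unit_square z -> 0 <= f z <= 1) ->
  mu.-integrable unit_square (EFin \o f).
Proof.
move=> mf f01; apply: measurable_bounded_integrable.
- exact: measurable_unit_square.
- by rewrite ltey_eq fin_num_measure//; exact: measurable_unit_square.
- exact: measurable_funTS.
- exists 1; split=> // M M1 z /f01/andP[f0 f1].
  by rewrite /= ger0_norm// (le_trans f1)// ltW.
Qed.

Lemma mean_fineK mu f : measurable_fun setT f ->
  (forall z, unit_square z -> 0 <= f z <= 1) ->
  (mean mu f)%:E = (\int[mu]_(z in unit_square) (f z)%:E)%E.
Proof.
move=> mf f01; rewrite /mean /Rintegral fineK//.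
by apply: integrable_fin_num; [exact: measurable_unit_square|exact: unit_integrable].
Qed.

Lemma eq_mean mu f g : (forall z, unit_square z -> f z = g z) -> mean mu f = mean mu g.
Proof. by move=> fg; apply: eq_Rintegral => z /set_mem; exact: fg. Qed.

Lemma mean_onem mu f : uniform_margins mu -> measurable_fun setT f ->
  (forall z, unit_square z -> 0 <= f z <= 1) -> mean mu (fun z => 1 - f z) = 1 - mean mu f.
Proof.
move=> unif mf f01; have m1 : measurable_fun setT (cst 1 : plane R -> R) by exact: measurable_cst.
rewrite /mean RintegralB//.
- by rewrite Rintegral_cst ?prob_unit_square ?mulr1//; exact: measurable_unit_square.
- exact: measurable_unit_square.
- by apply: (unit_integrable _ m1) => z _; rewrite /= ler01 lexx.
- exact: unit_integrable.
Qed.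

(** A lower Darboux sum. Upper sums come from applying it to [1 - f] with [mean_onem]. *)
Lemma sum_indic_le_mean (J : finType) (C : J -> set (plane R)) (l : J -> R) mu f :
  (forall p, measurable (C p)) -> (forall p, C p `<=` unit_square) ->
  (forall p q z, C p z -> C q z -> p = q) -> (forall p, 0 <= l p) ->
  measurable_fun setT f -> (forall z, unit_square z -> 0 <= f z <= 1) ->
  (forall p z, C p z -> l p <= f z) ->
  \sum_p l p * fine (mu (C p)) <= mean mu f.
Proof.
move=> mC sC dC l0 mf f01 lf; have mS := @measurable_unit_square R.
rewrite -lee_fin mean_fineK//.
have -> : (\sum_p l p * fine (mu (C p)))%:E =
    (\int[mu]_(z in unit_square) \sum_p (l p)%:E * (\1_(C p) z)%:E)%E.
  have m1 p : measurable_fun unit_square (fun z => (\1_(C p) z)%:E : \bar R).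
    by apply/measurable_EFinP; exact: measurable_indic.
  rewrite ge0_integral_sum//.
  - rewrite -sumEFin; apply: eq_bigr => p _.
    rewrite ge0_integralZl// ?lee_fin ?l0//.
    by rewrite integral_indic// setIidl// EFinM prob_fineK.
  - by move=> p; apply: emeasurable_funM => //; exact: measurable_cst.
  - by move=> p z _; rewrite mule_ge0// lee_fin.
apply: ge0_le_integral => //.
- by move=> z _; apply: sume_ge0 => p _; rewrite mule_ge0// lee_fin.
- apply: emeasurable_sum => p; apply: emeasurable_funM; first exact: measurable_cst.
  by apply/measurable_EFinP; exact: measurable_indic.
- by apply/measurable_EFinP; exact: measurable_funTS.
- move=> z Sz; have [[p Cp]|nC] := pselect (exists p, C p z).
    rewrite (bigD1 p)//= big1 => [|q qp].
      by rewrite addr0 indicE mem_set// mule1 lee_fin; exact: lf.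
    by rewrite indicE memNset ?mule0// => Cq; rewrite (dC _ _ _ Cq Cp) eqxx in qp.
  rewrite big1 => [|p _]; first by rewrite lee_fin; case/andP: (f01 z Sz).
  by rewrite indicE memNset ?mule0// => Cp; apply: nC; exists p.
Qed.

End Integrals.

(** * The graph of an N by N grid *)

Section Grid.
Variables (R : realType) (mu : probability (plane R) R).
Hypothesis mu_unif : uniform_margins mu.
Variable N : nat.
Hypothesis N0 : (0 < N)%N.

Let F := cdf2 mu.
Let t (i : nat) : R := i%:R / N%:R.
(** Half-open cells are disjoint, and the axes they leave out have no mass. *)
Let C (i j : nat) := cell (t i) (t i.+1) (t j) (t j.+1).
Let W (i j : nat) : R := fine (mu (C i j)).
Let J := ('I_N * 'I_N)%type.
Let pt (p : J) : nat * nat := (p.1 : nat, p.2 : nat).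
Let w (p : J) : R := W p.1 p.2.

Let Nr : 0 < N%:R :> R. Proof. by rewrite ltr0n. Qed.

Let t0 i : 0 <= t i. Proof. by rewrite divr_ge0. Qed.

Let tS i : t i.+1 = t i + N%:R^-1.
Proof. by rewrite /t -natr1 mulrDl mul1r. Qed.

Let t00 : t 0 = 0. Proof. by rewrite /t mul0r. Qed.

Let t_le1 i : (i <= N)%N -> t i <= 1.
Proof. by move=> iN; rewrite ler_pdivrMr// mul1r ler_nat. Qed.

Let tN : t N = 1. Proof. by rewrite /t divff// gt_eqF. Qed.

Let t_le i j : (i <= j)%N -> t i <= t j.
Proof. by move=> ij; rewrite ler_pM2r ?invr_gt0// ler_nat. Qed.

Let w0 p : 0 <= w p. Proof. exact: prob_ge0. Qed.

Let WE i j : W i j = (F (t i.+1) (t j.+1) - F (t i) (t j.+1)) - (F (t i.+1) (t j) - F (t i) (t j)).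
Proof. by rewrite /W prob_cell// ?t_le// /F; ring. Qed.

Let sum_W a b : (a <= N)%N -> (b <= N)%N ->
  \sum_(0 <= i < a) \sum_(0 <= j < b) W i j = F (t a) (t b).
Proof.
move=> aN bN; have sj i : (i < a)%N ->
    \sum_(0 <= j < b) W i j = F (t i.+1) (t b) - F (t i) (t b).
  move=> ia; under eq_bigr => j _ do rewrite WE.
  rewrite (telescope_sumr (fun j => F (t i.+1) (t j) - F (t i) (t j)))//.
  have iN : (i < N)%N := leq_trans ia aN.
  by rewrite t00 /F !cdf2_x0// ?t_le1//; [ring|exact: ltnW].
under eq_big_nat => i /andP[_ ia] do rewrite sj//.
rewrite (telescope_sumr (fun i => F (t i) (t b)))//.
by rewrite t00 /F cdf2_0y ?t_le1// subr0.
Qed.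

Let sum_cond a (f : nat -> R) : (a <= N)%N ->
  \sum_(i < N) (i < a)%:R * f i = \sum_(0 <= i < a) f i.
Proof.
move=> aN; rewrite big_mkord (big_ord_widen N f aN) [RHS]big_mkcond.
by apply: eq_bigr => i _; case: ifP; rewrite ?mul1r ?mul0r.
Qed.

Let sum_w a b : (a <= N)%N -> (b <= N)%N ->
  \sum_p w p * ((p.1 < a)%:R * (p.2 < b)%:R) = F (t a) (t b).
Proof.
move=> aN bN; rewrite -sum_W// -(pair_bigA _ (fun i j : 'I_N =>
  W i j * ((i < a)%:R * (j < b)%:R))) /= -sum_cond//.
apply: eq_bigr => i _; rewrite -sum_cond// mulr_sumr.
by apply: eq_bigr => j _; ring.
Qed.

Let sum_w1 : \sum_p w p = 1.
Proof.
rewrite -[RHS](_ : F (t N) (t N) = 1); last by rewrite tN /F cdf2_x1// ler01 lexx.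
by rewrite -sum_w//; apply: eq_bigr => p _; rewrite !ltn_ord !mulr1.
Qed.

Let cdfXE p : cdfX pt w p = t p.1.+1.
Proof.
have -> : t p.1.+1 = F (t p.1.+1) (t N) by rewrite tN /F cdf2_x1// t0 t_le1.
rewrite -sum_w//; apply: eq_bigr => q _.
by rewrite ltn_ord mulr1 /= ltnS.
Qed.

Let cdfYE p : cdfY pt w p = t p.2.+1.
Proof.
have -> : t p.2.+1 = F (t N) (t p.2.+1) by rewrite tN /F cdf2_1y// t0 t_le1.
rewrite -sum_w//; apply: eq_bigr => q _.
by rewrite ltn_ord mul1r /= ltnS.
Qed.

Let cell_unique (p q : J) z : C p.1 p.2 z -> C q.1 q.2 z -> p = q.
Proof.
have key (i i' : nat) (x : R) : t i < x <= t i.+1 -> t i' < x <= t i'.+1 -> i = i'.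
  move=> /andP[h1 h2] /andP[h3 h4]; have lt (a b : nat) : t a < t b.+1 -> (a <= b)%N.
    by rewrite ltr_pM2r ?invr_gt0// ltr_nat ltnS.
  apply/eqP; rewrite eqn_leq.
  by rewrite (lt _ _ (lt_le_trans h1 h4)) (lt _ _ (lt_le_trans h3 h2)).
case: p q z => [p1 p2] [q1 q2] [x y] [/=]; rewrite !in_itv/= => px py [/=].
rewrite !in_itv/= => qx qy; congr pair; apply: val_inj => /=.
  exact: key px qx.
exact: key py qy.
Qed.

Let cell_sub (p : J) : C p.1 p.2 `<=` unit_square.
Proof.
move=> [x y] [/=]; rewrite !in_itv/= => /andP[px xp] /andP[py yp].
split; rewrite /= in_itv/=.
  by rewrite (le_trans (t0 _) (ltW px)) (le_trans xp)// t_le1.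
by rewrite (le_trans (t0 _) (ltW py)) (le_trans yp)// t_le1.
Qed.

Let sum_le_mean (l : J -> R) (f : plane R -> R) : (forall p : J, 0 <= l p) ->
  measurable_fun setT f -> (forall z, unit_square z -> 0 <= f z <= 1) ->
  (forall (p : J) z, C p.1 p.2 z -> l p <= f z) -> \sum_p w p * l p <= mean mu f.
Proof.
move=> l0 mf f01 lf; under eq_bigr => p _ do rewrite mulrC.
apply: (@sum_indic_le_mean _ J (fun p => C p.1 p.2)) => //.
by move=> p; exact: measurable_cell.
Qed.

Let cdf2_01 (z : plane R) : unit_square z -> 0 <= F z.1 z.2 <= 1.
Proof.
move=> [/=]; rewrite !in_itv/= => /andP[x0 x1] /andP[y0 y1].
by rewrite cdf2_ge0/= (le_trans _ x1)// cdf2_lex.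
Qed.

Let cellP (p : J) (z : plane R) : C p.1 p.2 z ->
  [/\ t p.1 <= z.1, z.1 <= t p.1.+1, t p.2 <= z.2 & z.2 <= t p.2.+1].
Proof.
by move=> [/=]; rewrite !in_itv/= => /andP[px xp] /andP[py yp]; split => //; exact: ltW.
Qed.

Let mF := measurable_cdf2 mu.

Lemma sum_cdf2_le_mean : \sum_p w p * F (t p.1) (t p.2) <= mean mu (fun z => F z.1 z.2).
Proof.
apply: sum_le_mean => //; first by move=> p; exact: cdf2_ge0.
by move=> p z /cellP[? ? ? ?]; exact: le_cdf2.
Qed.

Lemma mean_le_sum_cdf2 :
  mean mu (fun z => F z.1 z.2) <= \sum_p w p * F (t p.1.+1) (t p.2.+1).
Proof.
rewrite -lerN2 -(lerD2l 1) -mean_onem//.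
have -> : 1 - \sum_p w p * F (t p.1.+1) (t p.2.+1) =
    \sum_p w p * (1 - F (t p.1.+1) (t p.2.+1)).
  rewrite -[X in X - _ = _]sum_w1 -sumrB; apply: eq_bigr => p _.
  by rewrite mulrBr mulr1.
apply: sum_le_mean => [p||z /cdf2_01|p z /cellP[? ? ? ?]].
- by rewrite subr_ge0 (le_trans (cdf2_lex _ _ _ _)) ?t_le1.
- by apply: measurable_funB => //; exact: measurable_cst.
- by move=> /andP[? ?]; apply/andP; split; lra.
- by rewrite lerD2l lerN2; exact: le_cdf2.
Qed.

(** The two boxes differ by part of a column and part of a row of the grid, each of mass [1 / N]. *)
Let cdf2_step i j : (i < N)%N -> (j < N)%N ->
  F (t i.+1) (t j.+1) <= F (t i) (t j) + 2 / N%:R.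
Proof.
move=> iN jN.
have c1 : 0 <= fine (mu (cell (t i) (t i.+1) (t j.+1) (t N))) by exact: prob_ge0.
have c2 : 0 <= fine (mu (cell (t i) (t N) (t j) (t j.+1))) by exact: prob_ge0.
have c3 : 0 <= fine (mu (cell (t i) (t i.+1) (t j) (t j.+1))) by exact: prob_ge0.
move: c1 c2; rewrite !prob_cell ?t_le//; try by rewrite ltnW.
rewrite tN !cdf2_x1 ?t0 ?t_le1 ?(ltnW iN)// !cdf2_1y ?t0 ?t_le1 ?(ltnW jN)//.
by rewrite -/F (tS i) (tS j); lra.
Qed.

Let sum_strict : \sum_p w p * F (t p.1) (t p.2) =
  \sum_p \sum_q w p * w q * ((q.1 < p.1)%:R * (q.2 < p.2)%:R).
Proof.
apply: eq_bigr => p _; rewrite -sum_w; [|exact: ltnW..].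
by rewrite mulr_sumr; apply: eq_bigr => q _; rewrite mulrA.
Qed.

Let sum_weak : \sum_p w p * F (t p.1.+1) (t p.2.+1) =
  \sum_p \sum_q w p * w q * ((q.1 <= p.1)%:R * (q.2 <= p.2)%:R).
Proof.
apply: eq_bigr => p _; rewrite -sum_w//.
by rewrite mulr_sumr; apply: eq_bigr => q _; rewrite mulrA !ltnS.
Qed.

Let sum_ww : \sum_p \sum_q w p * w q = 1.
Proof.
rewrite -[RHS]sum_w1; apply: eq_bigr => p _.
by rewrite -mulr_sumr sum_w1 mulr1.
Qed.

Let double_sum (f : J -> J -> R) :
  2 * \sum_p \sum_q w p * w q * f p q = \sum_p \sum_q w p * w q * (f p q + f q p).
Proof.
rewrite [2 * _](_ : _ = \sum_p \sum_q w p * w q * f p q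
   + \sum_p \sum_q w p * w q * f p q); last by ring.
rewrite {2}exchange_big -big_split; apply: eq_bigr => p _ /=.
by rewrite -big_split; apply: eq_bigr => q _ /=; ring.
Qed.

(** Two cells are discordant, strictly concordant or tied. The lower corners of the cells count ties
    as not concordant, the upper corners as concordant, which brackets the edge density. *)
Let edges_strict : edges w (disc R pt) <= 1 - 2 * \sum_p w p * F (t p.1) (t p.2).
Proof.
rewrite sum_strict double_sum -[X in X - _]sum_ww -sumrB; apply: ler_sum => p _.
rewrite -sumrB; apply: ler_sum => q _.
rewrite -[X in X - _]mulr1 -mulrBr ler_wpM2l ?mulr_ge0// -!natrM !mulnb -natrD.
rewrite lerBrDr /disc -natrD (ler_nat R _ 1) /discordant /=.
by case: (ltngtP p.1 q.1); case: (ltngtP p.2 q.2).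
Qed.

Let edges_weak : 1 - 2 * \sum_p w p * F (t p.1.+1) (t p.2.+1) <= edges w (disc R pt).
Proof.
rewrite sum_weak double_sum -[X in X - _]sum_ww -sumrB; apply: ler_sum => p _.
rewrite -sumrB; apply: ler_sum => q _.
rewrite -[X in X - _]mulr1 -mulrBr ler_wpM2l ?mulr_ge0// -!natrM !mulnb -natrD.
rewrite lerBlDr /disc -natrD (ler_nat R 1) /discordant /=.
by case: (ltngtP p.1 q.1); case: (ltngtP p.2 q.2).
Qed.

Lemma edges_approx :
  `|1 - edges w (disc R pt) - 2 * mean mu (fun z => F z.1 z.2)| <= 4 / N%:R.
Proof.
have h1 := sum_cdf2_le_mean; have h2 := mean_le_sum_cdf2.
have h3 := edges_strict; have h4 := edges_weak.
have h5 : \sum_p w p * F (t p.1.+1) (t p.2.+1) <=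
    \sum_p w p * F (t p.1) (t p.2) + 2 / N%:R.
  rewrite -[2 / _]mul1r -[X in X * (2 / _)]sum_w1 mulr_suml -big_split /=.
  by apply: ler_sum => p _; rewrite -mulrDr ler_wpM2l// cdf2_step.
have e4 : 4 / N%:R = 2 * (2 / N%:R) :> R by ring.
by rewrite ler_norml e4; apply/andP; split; lra.
Qed.

Lemma mean_prod_approx : 12 * \sum_p w p * cdfX pt w p * cdfY pt w p <=
  12 * mean mu (fun z => z.1 * z.2) + 24 / N%:R.
Proof.
have h1 : \sum_p w p * (t p.1 * t p.2) <= mean mu (fun z => z.1 * z.2).
  apply: sum_le_mean => [p||[x y] [/=]|p z /cellP[? ? ? ?]].
  - by rewrite mulr_ge0.
  - by apply: measurable_funM; [exact: measurable_fst|exact: measurable_snd].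
  - rewrite !in_itv/= => /andP[x0 x1] /andP[y0 y1].
    by rewrite mulr_ge0//= mulr_ile1.
  - exact: ler_pM.
have h2 : \sum_p w p * cdfX pt w p * cdfY pt w p <=
    \sum_p w p * (t p.1 * t p.2) + 2 / N%:R.
  rewrite -[2 / _]mul1r -[X in X * (2 / _)]sum_w1 mulr_suml -big_split /=.
  apply: ler_sum => p _; rewrite cdfXE cdfYE -mulrA -mulrDr ler_wpM2l//.
  have := t_le1 (ltn_ord p.1); have := t_le1 (ltn_ord p.2); have := t0 p.1; have := t0 p.2.
  have : 0 < N%:R^-1 :> R by rewrite invr_gt0.
  rewrite (tS p.1) (tS p.2); move: (t p.1) (t p.2) (N%:R^-1) => x y e; nra.
have e24 : 24 / N%:R = 12 * (2 / N%:R) :> R by ring.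
by rewrite e24; lra.
Qed.

Section Marginal.
Variables (sel : J -> nat) (pr : plane R -> R).
Hypothesis selN : forall p, (sel p < N)%N.
Hypothesis sel_cdf : forall a, (a <= N)%N -> t a = \sum_q w q * (sel q < a)%:R.
Hypothesis sel_cell : forall (p : J) z, C p.1 p.2 z -> t (sel p) <= pr z <= t (sel p).+1.
Hypothesis mpr : measurable_fun setT pr.
Hypothesis pr01 : forall z, unit_square z -> 0 <= pr z <= 1.

(** [sel] and [pr] are the same coordinate of a cell and of a point. Of two independent cells at
    most one comes strictly first and at least one weakly first, so the lower and upper sums enclose
    1/2. *)
Lemma mean_marginal_approx : `|mean mu pr - 1 / 2| <= 1 / N%:R.
Proof.
have h1 : \sum_p w p * t (sel p) <= mean mu pr.
  by apply: sum_le_mean => // p z /sel_cell/andP[].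
have h2 : mean mu pr <= \sum_p w p * t (sel p).+1.
  rewrite -lerN2 -(lerD2l 1) -mean_onem//.
  have -> : 1 - \sum_p w p * t (sel p).+1 = \sum_p w p * (1 - t (sel p).+1).
    rewrite -[X in X - _ = _]sum_w1 -sumrB; apply: eq_bigr => p _.
    by rewrite mulrBr mulr1.
  apply: sum_le_mean => [p||z /pr01|p z /sel_cell/andP[_ ?]].
  - by rewrite subr_ge0 t_le1.
  - by apply: measurable_funB => //; exact: measurable_cst.
  - by move=> /andP[? ?]; apply/andP; split; lra.
  - by rewrite lerD2l lerN2.
have h3 : \sum_p w p * t (sel p).+1 = \sum_p w p * t (sel p) + 1 / N%:R.
  rewrite -[1 / _]mul1r -[X in _ + X * _]sum_w1 mulr_suml -big_split /=.
  by apply: eq_bigr => p _; rewrite tS; field; rewrite gt_eqF.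
have h4 : 2 * \sum_p w p * t (sel p) <= 1.
  have -> : \sum_p w p * t (sel p) = \sum_p \sum_q w p * w q * (sel q < sel p)%:R.
    apply: eq_bigr => p _; rewrite sel_cdf; last exact: ltnW.
    by rewrite mulr_sumr; apply: eq_bigr => q _; rewrite mulrA.
  rewrite double_sum -[leRHS]sum_ww; apply: ler_sum => p _; apply: ler_sum => q _.
  rewrite -[leRHS]mulr1 ler_wpM2l ?mulr_ge0// -natrD (ler_nat R _ 1).
  by case: (ltngtP (sel q) (sel p)).
have h5 : 1 <= 2 * \sum_p w p * t (sel p).+1.
  have -> : \sum_p w p * t (sel p).+1 = \sum_p \sum_q w p * w q * (sel q <= sel p)%:R.
    apply: eq_bigr => p _; rewrite sel_cdf//.
    by rewrite mulr_sumr; apply: eq_bigr => q _; rewrite mulrA ltnS.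
  rewrite double_sum -[leLHS]sum_ww; apply: ler_sum => p _; apply: ler_sum => q _.
  rewrite -[leLHS]mulr1 ler_wpM2l ?mulr_ge0// -natrD (ler_nat R 1).
  by case: (ltngtP (sel q) (sel p)).
by rewrite ler_norml; apply/andP; split; lra.
Qed.

End Marginal.

Lemma mean_fst_approx : `|mean mu fst - 1 / 2| <= 1 / N%:R.
Proof.
apply: (@mean_marginal_approx (fun p => p.1)) => [//|a aN|p z /cellP[? ? _ _]||].
- have aE : t a = F (t a) (t N) by rewrite tN /F cdf2_x1// t0 t_le1.
  rewrite [LHS]aE -sum_w//; apply: eq_bigr => q _.
  by rewrite ltn_ord mulr1.
- exact/andP.
- exact: measurable_fst.
- by move=> [x y] [/=]; rewrite !in_itv/= => /andP[-> ->].
Qed.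

Lemma mean_snd_approx : `|mean mu snd - 1 / 2| <= 1 / N%:R.
Proof.
apply: (@mean_marginal_approx (fun p => p.2)) => [//|a aN|p z /cellP[_ _ ? ?]||].
- have aE : t a = F (t N) (t a) by rewrite tN /F cdf2_1y// t0 t_le1.
  rewrite [LHS]aE -sum_w//; apply: eq_bigr => q _.
  by rewrite ltn_ord mul1r.
- exact/andP.
- exact: measurable_snd.
- by move=> [x y] [/=]; rewrite !in_itv/= => _ /andP[-> ->].
Qed.

Lemma grid_graph : exists (I : finType) (u : I -> R) (a : I -> I -> R),
  [/\ wgraph u a, \sum_i u i = 1,
    `|1 - edges u a - 2 * mean mu (fun z => F z.1 z.2)| <= 4 / N%:R &
    4 - 3 * edges u a + triangles u a <= 12 * mean mu (fun z => z.1 * z.2) + 24 / N%:R].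
Proof.
exists J, w, (disc R pt); split.
- exact: wgraph_disc.
- exact: sum_w1.
- exact: edges_approx.
- exact: le_trans (sum_cdf_ge pt w0 sum_w1) mean_prod_approx.
Qed.

End Grid.

(** * The lower bound for Spearman's rho *)

Section LowerBound.
Variable R : realType.
Implicit Types (mu : probability (plane R) R).

(* Twice the mean of the copula is the probability that two independent points
   are concordant; the two numbers below are (1 + tau) / 2 and (1 + rho) / 2. *)
Definition concordance mu : R := 2 * mean mu (fun z => cdf2 mu z.1 z.2).
Definition rescaled_rho mu : R := 6 * mean mu (fun z => z.1 * z.2) - 1.

Lemma le_add_inv_nat (x y c : R) n0 :
  (forall N, (n0 < N)%N -> x <= y + c / N%:R) -> x <= y.
Proof.
move=> h; rewrite leNgt; apply/negP => yx.
have d0 : 0 < x - y by rewrite subr_gt0.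
pose N := maxn n0.+1 (Num.bound (`|c| / (x - y))).
have N0 : 0 < N%:R :> R by rewrite ltr0n leq_max ltn0Sn.
have := h N; rewrite leq_max ltnSn => /(_ isT); apply/negP; rewrite -ltNge -ltrBrDl.
rewrite ltr_pdivrMr// mulrC -ltr_pdivrMr//.
apply: (@le_lt_trans _ _ (`|c| / (x - y))); first by rewrite ler_pM2r ?invr_gt0// ler_norm.
apply: (@lt_le_trans _ _ (Num.bound (`|c| / (x - y)))%:R).
  by apply: archi_boundP; rewrite divr_ge0// ltW.
by rewrite ler_nat leq_maxr.
Qed.

Section Bounds.
Variable mu : probability (plane R) R.
Hypothesis mu_unif : uniform_margins mu.

(** The strict inequality absorbs the grid error [4 / N]. Inserting [T >= 1 - 3 (1 - E) + 2 S] into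
    [4 - 3 E + T] cancels the edge density and leaves [2 + 2 S]. *)
Lemma rescaled_rho_ge_parts k (al be : R) : (0 < k)%N -> be <= al -> k%:R * al + be = 1 ->
  k%:R * al ^+ 2 + be ^+ 2 < concordance mu -> k%:R * al ^+ 3 + be ^+ 3 <= rescaled_rho mu.
Proof.
move=> k0 ba ab1 Pp; set P := _ + be ^+ 2 in Pp; set S := _ + be ^+ 3.
have d0 : 0 < concordance mu - P by rewrite subr_gt0.
apply: (@le_add_inv_nat _ _ 12 (Num.bound (4 / (concordance mu - P)))) => N nN.
have N0 : (0 < N)%N by rewrite (leq_ltn_trans _ nN).
have Nr : 0 < N%:R :> R by rewrite ltr0n.
have N4 : 4 / N%:R <= concordance mu - P.
  rewrite ler_pdivrMr// mulrC -ler_pdivrMr//.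
  have h4 : 0 <= 4 / (concordance mu - P) by rewrite divr_ge0// ltW.
  by apply: le_trans (ltW (archi_boundP h4)) _; rewrite ler_nat ltnW.
have [I [u [a [g m]]]] := grid_graph mu_unif N0.
rewrite -/(concordance mu) ler_norml => /andP[Q1 _] TE.
have QP : P <= 1 - edges u a by lra.
have := density_bound_all k0 g ba; rewrite m => /(_ ab1) /=; rewrite !expr1n => /(_ QP).
have h1 : 0 <= 3 * 1 / k%:R * (1 - edges u a - P).
  by rewrite mulr1 mulr_ge0 ?subr_ge0// divr_ge0.
move=> h2.
have e24 : 24 / N%:R = 2 * (12 / N%:R) :> R by ring.
rewrite e24 -/P -/S in TE h2; rewrite /rescaled_rho; lra.
Qed.

Lemma concordance_ge0 : 0 <= concordance mu.
Proof. by rewrite mulr_ge0// Rintegral_ge0// => z _; exact: cdf2_ge0. Qed.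

Lemma edges_ge0 (I : finType) (u : I -> R) (a : I -> I -> R) : wgraph u a -> 0 <= edges u a.
Proof.
move=> [u0 a01 _]; apply: sumr_ge0 => i _; apply: sumr_ge0 => j _.
by rewrite !mulr_ge0//; case/andP: (a01 i j).
Qed.

Lemma concordance_le1 : concordance mu <= 1.
Proof.
apply: (@le_add_inv_nat _ _ 4 0) => N N0.
have [I [u [a [g m]]]] := grid_graph mu_unif N0.
rewrite -/(concordance mu) ler_norml => /andP[Q1 _] _.
by have := edges_ge0 g; lra.
Qed.

(** By Goodman's bound [4 - 3 E + T] is at least [2 + 2 (1 - E)^2]. *)
Lemma rescaled_rho_ge0 : 0 <= rescaled_rho mu.
Proof.
apply: (@le_add_inv_nat _ _ 12 0) => N N0.
have [I [u [a [g m _ TE]]]] := grid_graph mu_unif N0.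
have := goodman g m; have := sqr_ge0 (1 - edges u a) => h1 h2.
have e24 : 24 / N%:R = 2 * (12 / N%:R) :> R by ring.
have e2 : (1 - edges u a) ^+ 2 = 1 - 2 * edges u a + edges u a ^+ 2 by ring.
rewrite e24 in TE; rewrite e2 in h1; rewrite /rescaled_rho; lra.
Qed.

Lemma rescaled_rho_ge_part_cubes k : (0 < k)%N -> k.+1%:R^-1 < concordance mu ->
  part_cubes k (concordance mu) <= rescaled_rho mu.
Proof.
move=> k0 kp; have q0 := part_gap_gt0 k0 kp; have qE := part_gap_sqr k0 (ltW kp).
set q := part_gap k _ in q0 qE; set p := concordance mu in kp qE *.
have k1 : 1 <= k%:R :> R by rewrite (ler_nat R 1).
have kS : k.+1%:R = k%:R + 1 :> R by rewrite natr1.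
set K : R := k%:R in k1 kS qE.
(* Shrinking the gap from [q] to [q (1 - 1 / N)] makes the condition on the squares strict. The
   constant bounds the loss, as [q^2 - y^2 <= 2 q^2 / N]. *)
apply: (@le_add_inv_nat _ _ (6 * K * q ^+ 2 / (K + 1) ^+ 2) 0) => N N0.
have Nr : 1 <= N%:R :> R by rewrite (ler_nat R 1).
pose e := N%:R^-1 : R.
have e0 : 0 < e by rewrite invr_gt0; lra.
have e1 : e <= 1 by rewrite invf_le1//; lra.
pose y := q * (1 - e).
have yq : y < q by rewrite /y gtr_pMr//; lra.
have y0 : 0 <= y by rewrite /y mulr_ge0 ?subr_ge0 ?(ltW q0).
have := @rescaled_rho_ge_parts k ((1 + y) / (K + 1)) ((1 - K * y) / (K + 1)) k0.
rewrite ler_pM2r ?invr_gt0; last by lra.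
have Ky : 0 <= K * y by rewrite mulr_ge0//; lra.
move=> /(_ _)/wrap[]; first by lra.
move=> /(_ _)/wrap[]; first by rewrite -/K; field; lra.
move=> /(_ _)/wrap[].
  rewrite -/K [ltLHS](_ : _ = (1 + K * y ^+ 2) / (K + 1)); last by field; lra.
  rewrite -/p [ltRHS](_ : _ = (1 + K * q ^+ 2) / (K + 1)).
    rewrite ltr_pM2r ?invr_gt0; last by lra.
    rewrite ltrD2l ltr_pM2l; last by lra.
    by rewrite ltrXn2r// ltW.
  by rewrite qE kS; field; apply/andP; split; lra.
move=> S1; rewrite -/K in S1.
have : part_cubes k p - 6 * K * q ^+ 2 / (K + 1) ^+ 2 / N%:R <=
   K * ((1 + y) / (K + 1)) ^+ 3 + ((1 - K * y) / (K + 1)) ^+ 3.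
  rewrite -/e [leRHS](_ : _ = (1 + 3 * K * y ^+ 2 - K * (K - 1) * y ^+ 3) / (K + 1) ^+ 2).
    rewrite /part_cubes -/q -/K kS -subr_ge0.
    rewrite [leRHS](_ : _ = K * ((K - 1) * (q ^+ 3 - y ^+ 3)
        + 3 * q ^+ 2 * e ^+ 2) / (K + 1) ^+ 2); last by rewrite /y; field; lra.
    apply: divr_ge0; last exact: sqr_ge0.
    apply: mulr_ge0; first by lra.
    apply: addr_ge0; last by apply: mulr_ge0; [apply: mulr_ge0|]; rewrite ?sqr_ge0.
    apply: mulr_ge0; first by lra.
    by rewrite subr_ge0 lerXn2r// ?nnegrE// ltW.
  by field; lra.
lra.
Qed.

End Bounds.
End LowerBound.

(** * Shuffle-type constructions *)

Section Reflection.
Variable R : realType.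
Implicit Types (mu : probability (plane R) R) (f g : plane R -> R).

Definition unit_valued f := measurable_fun setT f /\
  (forall z, unit_square z -> 0 <= f z <= 1).

Lemma unit_squareP (z : plane R) : unit_square z -> 0 <= z.1 <= 1 /\ 0 <= z.2 <= 1.
Proof. by move=> [/=]; rewrite !in_itv. Qed.

Lemma unit_valued_fst : unit_valued fst.
Proof. by split=> [|z /unit_squareP[]//]; exact: measurable_fst. Qed.

Lemma unit_valued_snd : unit_valued snd.
Proof. by split=> [|z /unit_squareP[]//]; exact: measurable_snd. Qed.

Lemma unit_valued_prod : unit_valued (fun z => z.1 * z.2).
Proof.
split=> [|z /unit_squareP[/andP[x0 x1] /andP[y0 y1]]].
  by apply: measurable_funM; [exact: measurable_fst|exact: measurable_snd].
by rewrite mulr_ge0//= mulr_ile1.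
Qed.

Lemma unit_valued_cdf2 mu : uniform_margins mu ->
  unit_valued (fun z => cdf2 mu z.1 z.2).
Proof.
move=> unif; split=> [|z /unit_squareP[/andP[x0 x1] /andP[y0 y1]]].
  exact: measurable_cdf2.
by rewrite cdf2_ge0/= (le_trans _ x1)// cdf2_lex.
Qed.

Lemma mean_affine mu (a b : R) f g : unit_valued f -> unit_valued g ->
  mean mu (fun z => a * f z + b * g z) = a * mean mu f + b * mean mu g.
Proof.
move=> [mf f01] [mg g01]; have mS := @measurable_unit_square R.
have If := unit_integrable mu mf f01; have Ig := unit_integrable mu mg g01.
have IZ c h : mu.-integrable unit_square (EFin \o h) ->
    mu.-integrable unit_square (EFin \o (fun z => c * h z)).
  move=> Ih; have := integrableZl mS c Ih.
  by apply: eq_integrable => // z _; rewrite /= EFinM.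
rewrite /mean RintegralD//; [|exact: IZ..].
by rewrite !RintegralZl.
Qed.

Lemma mean_fst mu : uniform_margins mu -> mean mu fst = 1 / 2.
Proof.
move=> unif; apply/eqP; rewrite -subr_eq0 -normr_le0.
apply: (@le_add_inv_nat _ _ _ 1 0) => N N0.
by rewrite add0r; exact: mean_fst_approx.
Qed.

Lemma mean_snd mu : uniform_margins mu -> mean mu snd = 1 / 2.
Proof.
move=> unif; apply/eqP; rewrite -subr_eq0 -normr_le0.
apply: (@le_add_inv_nat _ _ _ 1 0) => N N0.
by rewrite add0r; exact: mean_snd_approx.
Qed.

Lemma measurable_sublevel (pr : plane R -> R) (a : R) : measurable_fun setT pr ->
  measurable [set z | pr z <= a].
Proof.
move=> mpr; rewrite -[X in measurable X]setTI.
by apply: measurable_fun_le => //; exact: measurable_cst.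
Qed.

Lemma measurable_level (pr : plane R -> R) (a : R) : measurable_fun setT pr ->
  measurable [set z | pr z = a].
Proof.
move=> mpr; rewrite [X in measurable X](_ : _ = pr @^-1` [set a])//.
by rewrite -[X in measurable X]setTI; exact: mpr.
Qed.

(** For [0 < c <= 1] the level set lies between the sublevel sets at [c] and at the larger of 0 and
    [c - 1 / N], whose difference has mass at most [1 / N]. *)
Lemma prob_level_uniform mu (pr : plane R -> R) (c : R) : unit_valued pr ->
  (forall a, 0 <= a <= 1 -> fine (mu (unit_square `&` [set z | pr z <= a])) = a) ->
  fine (mu (unit_square `&` [set z | pr z = c])) = 0.
Proof.
move=> [mpr pr01] unif; have mS := @measurable_unit_square R.
have ml a : measurable (unit_square `&` [set z | pr z <= a]).
  by apply: measurableI => //; exact: measurable_sublevel.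
have mL : measurable (unit_square `&` [set z | pr z = c]).
  by apply: measurableI => //; exact: measurable_level.
apply: le_anti; rewrite prob_ge0 andbT; apply: (@le_add_inv_nat _ _ _ 1 0) => N N0.
rewrite add0r; have [c01|nc01] := boolP (0 <= c <= 1); last first.
  rewrite (_ : _ `&` _ = set0) ?measure0 ?divr_ge0//.
  by rewrite -subset0 => z [/pr01 + /= zc]; rewrite zc; exact/negP.
have /andP[c0 c1] := c01; have Nr : 0 < N%:R^-1 :> R by rewrite invr_gt0 ltr0n.
pose a : R := Num.max 0 (c - N%:R^-1).
have a0 : 0 <= a by rewrite le_max lexx.
have ac : a <= c by rewrite ge_max c0 gerBl ltW.
rewrite mul1r; have [c_gt0|c_le0] := ltP 0 c; last first.
  apply: (@le_trans _ _ c); last exact: le_trans c_le0 (ltW Nr).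
  rewrite -[leRHS]unif//; apply: le_prob => // z [Sz /= zc].
  by split=> //=; rewrite zc.
have a_lt_c : a < c by rewrite gt_max c_gt0 ltrBlDr ltrDl.
apply: (@le_trans _ _ (fine (mu ((unit_square `&` [set z | pr z <= c])
    `\` (unit_square `&` [set z | pr z <= a]))))).
  apply: le_prob => //; first exact: measurableD.
  move=> z [Sz /= zc]; split; first by split=> //=; rewrite zc.
  by move=> [_ /=]; rewrite zc leNgt a_lt_c.
rewrite prob_setD//; last by move=> z [Sz /= za]; split=> //=; exact: le_trans ac.
by rewrite !unif// ?a0 ?(le_trans ac)// lerBlDr -lerBlDl le_max lexx orbT.
Qed.

Lemma prob_vline mu (c : R) : uniform_margins mu ->
  fine (mu (unit_square `&` [set z | z.1 = c])) = 0.
Proof.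
move=> unif; apply: prob_level_uniform => [|a a01]; first exact: unit_valued_fst.
rewrite -[RHS](cdf2_x1 unif a01); congr (fine (mu _)); have /andP[a0 a1] := a01.
apply/seteqP; split=> [z [/unit_squareP[/andP[x0 _] y01] /= xa]|].
  by split; rewrite /= in_itv//= x0.
move=> z [/=]; rewrite !in_itv/= => /andP[x0 xa] y01; split=> //.
by split; rewrite /= in_itv//= x0 (le_trans xa).
Qed.

Lemma prob_hline mu (c : R) : uniform_margins mu ->
  fine (mu (unit_square `&` [set z | z.2 = c])) = 0.
Proof.
move=> unif; apply: prob_level_uniform => [|a a01]; first exact: unit_valued_snd.
rewrite -[RHS](cdf2_1y unif a01); congr (fine (mu _)); have /andP[a0 a1] := a01.
apply/seteqP; split=> [z [/unit_squareP[x01 /andP[y0 _]] /= ya]|].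
  by split; rewrite /= in_itv//= y0.
move=> z [/=]; rewrite !in_itv/= => x01 /andP[y0 ya]; split=> //.
by split; rewrite /= in_itv//= y0 (le_trans ya).
Qed.

Lemma prob_unit_squareC mu : uniform_margins mu -> mu (~` unit_square) = 0%E.
Proof.
move=> unif; have mS := @measurable_unit_square R.
by rewrite probability_setC// -(prob_fineK mu mS) prob_unit_square// -EFinB subrr.
Qed.

(** Preimages of boxes under reflections and block maps are boxes only up to boundary lines, which
    uniform margins make negligible. *)
Lemma prob_eq_off_lines mu (c d : R) (U V : set (plane R)) : uniform_margins mu ->
  measurable U -> measurable V ->
  (forall z, unit_square z -> z.1 <> c -> z.2 <> d -> U z <-> V z) ->
  fine (mu U) = fine (mu V).
Proof.
move=> unif mU mV UV; have mS := @measurable_unit_square R.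
pose N := ~` unit_square `|` ((unit_square `&` [set z | z.1 = c])
  `|` (unit_square `&` [set z | z.2 = d])).
have mc : measurable (unit_square `&` [set z : plane R | z.1 = c]).
  by apply: measurableI => //; apply: measurable_level; exact: measurable_fst.
have md : measurable (unit_square `&` [set z : plane R | z.2 = d]).
  by apply: measurableI => //; apply: measurable_level; exact: measurable_snd.
have mN : measurable N by apply: measurableU; [exact: measurableC|exact: measurableU].
have muN : mu N = 0%E.
  have mu0 W : measurable W -> fine (mu W) = 0 -> mu W = 0%E.
    by move=> mW W0; rewrite -(prob_fineK mu mW) W0.
  have muSC := prob_unit_squareC unif.
  have muL : mu (unit_square `&` [set z | z.1 = c] `|` unit_square `&` [set z | z.2 = d]) = 0%E.
    by apply: null_set_setU => //; apply: mu0 => //; [exact: prob_vline|exact: prob_hline].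
  by apply: null_set_setU => //; [exact: measurableC|exact: measurableU].
have muD W : measurable W -> mu W = mu (W `\` N).
  move=> mW; rewrite (measureDI mu mW mN) [X in (_ + X)%E](_ : _ = 0%E) ?adde0//.
  by apply: (subset_measure0 _ _ _ muN) => //; exact: measurableI.
rewrite (muD _ mU) (muD _ mV); congr (fine (mu _)).
apply/seteqP; split=> z [Wz nN]; split=> //.
  have Sz : unit_square z by apply: contrapT => nS; apply: nN; left.
  by apply/(UV z Sz) => // ?; apply: nN; right; [left|right].
have Sz : unit_square z by apply: contrapT => nS; apply: nN; left.
by apply/(UV z Sz) => // ?; apply: nN; right; [left|right].
Qed.

Lemma integral_unit_square mu (D : set (plane R)) f : uniform_margins mu ->
  measurable D -> unit_square `<=` D -> measurable_fun D f ->
  (forall z, D z -> 0 <= f z) ->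
  (\int[mu]_(z in D) (f z)%:E = \int[mu]_(z in unit_square) (f z)%:E)%E.
Proof.
move=> unif mD SD mf f0; have mS := @measurable_unit_square R.
rewrite (@ge0_negligible_integral _ _ _ mu D (D `\` unit_square))//.
- by congr (integral mu _ _); rewrite setDD setIidr.
- exact: measurableD.
- exact/measurable_EFinP.
- apply: (subset_measure0 _ _ _ (prob_unit_squareC unif)) => //.
  + exact: measurableD.
  + exact: measurableC.
Qed.

End Reflection.

(** * Realisable pairs and reflection *)

Section Realizable.
Variable R : realType.
Implicit Types (mu : probability (plane R) R) (f : plane R -> R).

Definition realizable (p r : R) :=
  exists mu, [/\ uniform_margins mu, concordance mu = p & rescaled_rho mu = r].

Definition reflect (z : plane R) : plane R := (z.1, 1 - z.2).

Lemma measurable_reflect : measurable_fun setT reflect.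
Proof.
apply: measurable_fun_pair; first exact: measurable_fst.
by apply: measurable_funB; [exact: measurable_cst|exact: measurable_snd].
Qed.

HB.instance Definition _ :=
  isMeasurableFun.Build _ _ _ _ reflect measurable_reflect.

Lemma reflect_unit_square : reflect @^-1` unit_square = unit_square.
Proof.
by apply/seteqP; split=> -[x y] [/=]; rewrite !in_itv/= => x01 y01;
  split; rewrite /= in_itv//=; lra.
Qed.

Lemma mean_distribution mu (X : {mfun (plane R) >-> (plane R)}) f :
  X @^-1` unit_square = unit_square -> unit_valued f ->
  mean (distribution mu X) f = mean mu (f \o X).
Proof.
move=> XS [mf f01]; rewrite /mean /Rintegral; congr fine.
rewrite ge0_integral_pushforward ?XS//.
- exact: measurable_unit_square.
- by apply/measurable_EFinP; exact: measurable_funTS.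
- by move=> z /set_mem/f01/andP[]; rewrite lee_fin.
Qed.

Lemma measurable_preimage (g : plane R -> plane R) (U : set (plane R)) :
  measurable_fun setT g -> measurable U -> measurable (g @^-1` U).
Proof. by move=> mg mU; rewrite -[X in measurable X]setTI; exact: mg. Qed.

Section Reflected.
Variable mu : probability (plane R) R.
Hypothesis mu_unif : uniform_margins mu.

Definition reflected : probability (plane R) R := distribution mu reflect.

Lemma cdf2_reflected x y : 0 <= x <= 1 -> 0 <= y <= 1 ->
  cdf2 reflected x y = x - cdf2 mu x (1 - y).
Proof.
move=> x01 y01; have /andP[x0 x1] := x01; have /andP[y0 y1] := y01.
rewrite -{2}(cdf2_x1 mu_unif x01) -prob_setD; [|exact: measurable_box..|]; last first.
  move=> z [/=]; rewrite !in_itv/= => z1 /andP[z20 z21].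
  by split; rewrite /= in_itv//=; lra.
apply: (prob_eq_off_lines (c := 0) (d := 1 - y) mu_unif).
- by apply: measurable_preimage; [exact: measurable_reflect|exact: measurable_box].
- by apply: measurableD; exact: measurable_box.
- move=> [a b] /unit_squareP[/= a01 b01] _ bd; split=> [[/=]|[[/=]]].
    rewrite !in_itv/= => ax b1; split; first by split; rewrite /= in_itv//=; lra.
    move=> [_ /=]; rewrite in_itv/= => /andP[_ bd']; apply: bd.
    by apply/le_anti; rewrite bd' andTb; lra.
  rewrite !in_itv/= => ax _ nb; split; rewrite /= in_itv//=.
  have : 1 - y < b.
    by rewrite ltNge; apply/negP => h; apply: nb; split; rewrite /= in_itv//= h; lra.
  lra.
Qed.

Lemma uniform_margins_reflected : uniform_margins reflected.
Proof.
have i1 : 0 <= (1 : R) <= 1 by rewrite ler01 lexx.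
split=> z z01; rewrite cdf2_reflected//.
  by rewrite subrr cdf2_x0 ?subr0//; case/andP: z01.
by rewrite cdf2_1y//; [ring|lra].
Qed.

Lemma concordance_reflected : concordance reflected = 1 - concordance mu.
Proof.
rewrite /concordance mean_distribution; first last.
- exact: unit_valued_cdf2 uniform_margins_reflected.
- exact: reflect_unit_square.
rewrite (@eq_mean _ _ _ (fun z => 1 * z.1 + - 1 * cdf2 mu z.1 z.2)); last first.
  move=> z /unit_squareP[x01 y01]; rewrite /= cdf2_reflected//; last by lra.
  by rewrite subKr; ring.
rewrite (mean_affine _ _ _ (unit_valued_fst R) (unit_valued_cdf2 mu_unif)) mean_fst//.
by field.
Qed.

Lemma rescaled_rho_reflected : rescaled_rho reflected = 1 - rescaled_rho mu.
Proof.
rewrite /rescaled_rho mean_distribution; first last.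
- exact: unit_valued_prod.
- exact: reflect_unit_square.
rewrite (@eq_mean _ _ _ (fun z => 1 * z.1 + - 1 * (z.1 * z.2))); last first.
  by move=> z _ /=; ring.
rewrite (mean_affine _ _ _ (unit_valued_fst R) (unit_valued_prod R)) mean_fst//.
by field.
Qed.

End Reflected.

Lemma realizable_reflect p r : realizable p r -> realizable (1 - p) (1 - r).
Proof.
move=> [mu [unif <- <-]]; exists (reflected mu); split.
- exact: uniform_margins_reflected.
- exact: concordance_reflected.
- exact: rescaled_rho_reflected.
Qed.

Lemma realizable_bounds p r : realizable p r -> [/\ 0 <= p <= 1, 0 <= r <= 1 &
  forall k, (0 < k)%N -> k.+1%:R^-1 < p -> part_cubes k p <= r].
Proof.
move=> [mu [unif <- <-]]; have unif' := uniform_margins_reflected unif.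
split.
- by rewrite concordance_ge0// concordance_le1.
- by rewrite rescaled_rho_ge0//=; have := rescaled_rho_ge0 unif'; rewrite rescaled_rho_reflected//; lra.
- by move=> k; exact: rescaled_rho_ge_part_cubes.
Qed.

End Realizable.

Section Mixture.
Context d (T : measurableType d) (R : realType).
Variables (a b : {nonneg R}) (ab : a%:num + b%:num = 1) (P Q : probability T R).

(** The proof that the weights add up to 1 is an argument, so that the probability structure can be
    recovered from the term. *)
Definition mixture (_ : a%:num + b%:num = 1) : set T -> \bar R :=
  measure_add (mscale a P) (mscale b Q).

HB.instance Definition _ := Measure.on (mixture ab).

Lemma mixtureE U : mixture ab U = (a%:num%:E * P U + b%:num%:E * Q U)%E.
Proof. by rewrite /mixture measure_addE. Qed.

Let mixture_setT : mixture ab setT = 1%E.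
Proof. by rewrite mixtureE !probability_setT !mule1 -EFinD ab. Qed.

HB.instance Definition _ := Measure_isProbability.Build _ _ _ (mixture ab) mixture_setT.

End Mixture.

(** * Skew sums of two measures *)

Section SkewSum.
Variable R : realType.
Implicit Types (f : plane R -> R).

(** With [lower_right], the two blocks are [[0, th] x [1 - th, 1]] and [[th, 1] x [0, 1 - th]], so
    interior points of different blocks are discordant. *)
Definition upper_left (th : R) (z : plane R) : plane R :=
  (th * z.1, 1 - th + th * z.2).

Definition lower_right (th : R) (z : plane R) : plane R :=
  (th + (1 - th) * z.1, (1 - th) * z.2).

Lemma measurable_upper_left th : measurable_fun setT (upper_left th).
Proof.
apply: measurable_fun_pair.
  by apply: measurable_funM; [exact: measurable_cst|exact: measurable_fst].
apply: measurable_funD; first exact: measurable_cst.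
by apply: measurable_funM; [exact: measurable_cst|exact: measurable_snd].
Qed.

Lemma measurable_lower_right th : measurable_fun setT (lower_right th).
Proof.
apply: measurable_fun_pair.
  apply: measurable_funD; first exact: measurable_cst.
  by apply: measurable_funM; [exact: measurable_cst|exact: measurable_fst].
by apply: measurable_funM; [exact: measurable_cst|exact: measurable_snd].
Qed.

HB.instance Definition _ th :=
  isMeasurableFun.Build _ _ _ _ (upper_left th) (measurable_upper_left th).
HB.instance Definition _ th :=
  isMeasurableFun.Build _ _ _ _ (lower_right th) (measurable_lower_right th).

Variables (th : R) (th01 : 0 < th < 1) (mu1 mu2 : probability (plane R) R).
Hypothesis unif1 : uniform_margins mu1.
Hypothesis unif2 : uniform_margins mu2.

Let th0 : 0 < th. Proof. by case/andP: th01. Qed.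
Let th1 : th < 1. Proof. by case/andP: th01. Qed.
Let th1' : 0 < 1 - th. Proof. by rewrite subr_gt0. Qed.

Let weights : (NngNum (ltW th0))%:num + (NngNum (ltW th1'))%:num = 1.
Proof. by rewrite /=; ring. Qed.

Definition skew_sum : probability (plane R) R :=
  mixture (distribution mu1 (upper_left th)) (distribution mu2 (lower_right th)) weights.

Lemma prob_skew_sum U : measurable U -> fine (skew_sum U) =
  th * fine (mu1 (upper_left th @^-1` U)) + (1 - th) * fine (mu2 (lower_right th @^-1` U)).
Proof.
move=> mU.
have -> : skew_sum U = (th%:E * mu1 (upper_left th @^-1` U) +
    (1 - th)%:E * mu2 (lower_right th @^-1` U))%E by exact: mixtureE.
rewrite -(prob_fineK mu1 (A := upper_left th @^-1` U)); last first.
  by apply: measurable_preimage => //; exact: measurable_upper_left.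
rewrite -(prob_fineK mu2 (A := lower_right th @^-1` U)) //.
by apply: measurable_preimage => //; exact: measurable_lower_right.
Qed.

Lemma cdf2_skew_sum x y : cdf2 skew_sum x y =
  th * fine (mu1 (upper_left th @^-1` box x y))
  + (1 - th) * fine (mu2 (lower_right th @^-1` box x y)).
Proof. by rewrite /cdf2 prob_skew_sum//; exact: measurable_box. Qed.

Let mUL x y : measurable (upper_left th @^-1` box x y).
Proof.
by apply: measurable_preimage; [exact: measurable_upper_left|exact: measurable_box].
Qed.

Let mLR x y : measurable (lower_right th @^-1` box x y).
Proof.
by apply: measurable_preimage; [exact: measurable_lower_right|exact: measurable_box].
Qed.

Lemma prob_upper_left x y a b :
  (forall z : plane R, unit_square z -> z.1 <> 0 -> z.2 <> 0 ->
    (0 <= th * z.1 <= x /\ 0 <= 1 - th + th * z.2 <= y) <->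
    (0 <= z.1 <= a /\ 0 <= z.2 <= b)) ->
  fine (mu1 (upper_left th @^-1` box x y)) = cdf2 mu1 a b.
Proof.
by move=> h; apply: (prob_eq_off_lines (c := 0) (d := 0) unif1) => //; exact: measurable_box.
Qed.

Lemma prob_lower_right x y a b :
  (forall z : plane R, unit_square z -> z.1 <> 0 -> z.2 <> 0 ->
    (0 <= th + (1 - th) * z.1 <= x /\ 0 <= (1 - th) * z.2 <= y) <->
    (0 <= z.1 <= a /\ 0 <= z.2 <= b)) ->
  fine (mu2 (lower_right th @^-1` box x y)) = cdf2 mu2 a b.
Proof.
by move=> h; apply: (prob_eq_off_lines (c := 0) (d := 0) unif2) => //; exact: measurable_box.
Qed.

Let pos (z : plane R) : unit_square z -> z.1 <> 0 -> z.2 <> 0 ->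
  [/\ 0 < z.1, z.1 <= 1, 0 < z.2 & z.2 <= 1].
Proof.
move=> /unit_squareP[/andP[x0 x1] /andP[y0 y1]] /eqP nx /eqP ny.
by split=> //; rewrite lt0r ?nx ?ny.
Qed.

Lemma cdf2_skew_upper_left z : unit_square z ->
  cdf2 skew_sum (th * z.1) (1 - th + th * z.2) = th * cdf2 mu1 z.1 z.2.
Proof.
move=> /unit_squareP[/andP[x0 x1] /andP[y0 y1]]; rewrite cdf2_skew_sum.
rewrite (@prob_upper_left _ _ z.1 z.2) ?(@prob_lower_right _ _ 0 0).
- by rewrite cdf2_x0//; ring.
- move=> a Sa a1 a2; have [a10 a11 a20 a21] := pos Sa a1 a2; have [t0 t1] := (th0, th1).
  have : th * z.1 <= th by rewrite ler_piMr// ltW.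
  have : 0 < (1 - th) * a.1 by rewrite mulr_gt0.
  by move=> h1 h2; split=> [[/andP[_ ?] _]|[/andP[_ ?] _]]; lra.
- move=> a Sa a1 a2; have [a10 a11 a20 a21] := pos Sa a1 a2; have [t0 t1] := (th0, th1).
  rewrite lerD2l !ler_pM2l//.
  have : 0 <= th * a.1 by rewrite mulr_ge0 ?ltW.
  have : 0 <= th * a.2 by rewrite mulr_ge0 ?ltW.
  by move=> h1 h2; split=> -[/andP[_ ?] /andP[_ ?]]; split; apply/andP; split=> //; lra.
Qed.

Lemma cdf2_skew_lower_right z : unit_square z ->
  cdf2 skew_sum (th + (1 - th) * z.1) ((1 - th) * z.2) = (1 - th) * cdf2 mu2 z.1 z.2.
Proof.
move=> /unit_squareP[/andP[x0 x1] /andP[y0 y1]]; rewrite cdf2_skew_sum.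
rewrite (@prob_lower_right _ _ z.1 z.2) ?(@prob_upper_left _ _ 0 0).
- by rewrite cdf2_x0//; ring.
- move=> a Sa a1 a2; have [a10 a11 a20 a21] := pos Sa a1 a2; have [t0 t1] := (th0, th1).
  have : (1 - th) * z.2 <= 1 - th by rewrite ler_piMr// ltW.
  have : 0 < th * a.2 by rewrite mulr_gt0.
  by move=> h1 h2; split=> [[_ /andP[_ ?]]|[_ /andP[_ ?]]]; lra.
- move=> a Sa a1 a2; have [a10 a11 a20 a21] := pos Sa a1 a2; have [t0 t1] := (th0, th1).
  rewrite lerD2l !ler_pM2l//.
  have : 0 <= (1 - th) * a.1 by rewrite mulr_ge0 ?ltW.
  have : 0 <= (1 - th) * a.2 by rewrite mulr_ge0 ?ltW.
  by move=> h1 h2; split=> -[/andP[_ ?] /andP[_ ?]]; split; apply/andP; split=> //; lra.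
Qed.

Lemma uniform_margins_skew_sum : uniform_margins skew_sum.
Proof.
split=> [x /andP[x0 x1]|y /andP[y0 y1]]; rewrite cdf2_skew_sum.
  have [xth|thx] := leP x th.
    rewrite (@prob_upper_left _ _ (x / th) 1) ?(@prob_lower_right _ _ 0 0).
    - rewrite cdf2_x0// cdf2_x1//; first by field; rewrite gt_eqF.
      by rewrite divr_ge0 ?(ltW th0)//= ler_pdivrMr// mul1r.
    - move=> a Sa a1 a2; have [a10 a11 a20 a21] := pos Sa a1 a2; have [t0 t1] := (th0, th1).
      have : 0 < (1 - th) * a.1 by rewrite mulr_gt0.
      by move=> h1; split=> [[/andP[_ ?] _]|[/andP[_ ?] _]]; lra.
    - move=> a Sa a1 a2; have [a10 a11 a20 a21] := pos Sa a1 a2; have [t0 t1] := (th0, th1).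
      rewrite ler_pdivlMr// (mulrC a.1).
      have : 0 <= th * a.1 by rewrite mulr_ge0 ?ltW.
      have : 0 <= th * a.2 by rewrite mulr_ge0 ?ltW.
      have : th * a.2 <= th by rewrite ler_piMr// ltW.
      by move=> h1 h2 h3; split=> -[/andP[_ ?] /andP[_ ?]]; split; apply/andP; split=> //; lra.
  rewrite (@prob_upper_left _ _ 1 1) ?(@prob_lower_right _ _ ((x - th) / (1 - th)) 1).
  - rewrite !cdf2_x1 ?ler01 ?lexx//; first by field; rewrite gt_eqF.
    by rewrite divr_ge0 ?(ltW th1') ?subr_ge0 ?(ltW thx)//= ler_pdivrMr// mul1r lerD2r.
  - move=> a Sa a1 a2; have [a10 a11 a20 a21] := pos Sa a1 a2; have [t0 t1] := (th0, th1).
    rewrite ler_pdivlMr// (mulrC a.1) lerBrDl.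
    have : 0 <= (1 - th) * a.1 by rewrite mulr_ge0 ?ltW.
    have : 0 <= (1 - th) * a.2 by rewrite mulr_ge0 ?ltW.
    have : (1 - th) * a.2 <= 1 - th by rewrite ler_piMr// ltW.
    by move=> h1 h2 h3; split=> -[/andP[_ ?] /andP[_ ?]]; split; apply/andP; split=> //; lra.
  - move=> a Sa a1 a2; have [a10 a11 a20 a21] := pos Sa a1 a2; have [t0 t1] := (th0, th1).
    have : 0 <= th * a.1 by rewrite mulr_ge0 ?ltW.
    have : 0 <= th * a.2 by rewrite mulr_ge0 ?ltW.
    have : th * a.2 <= th by rewrite ler_piMr// ltW.
    have : th * a.1 <= th by rewrite ler_piMr// ltW.
    by move=> h1 h2 h3 h4; split=> -[/andP[_ ?] /andP[_ ?]]; split; apply/andP; split=> //; lra.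
have [yth|thy] := leP y (1 - th).
  rewrite (@prob_upper_left _ _ 0 0) ?(@prob_lower_right _ _ 1 (y / (1 - th))).
  - rewrite cdf2_x0// cdf2_1y//; first by field; rewrite gt_eqF.
    by rewrite divr_ge0 ?(ltW th1')//= ler_pdivrMr// mul1r.
  - move=> a Sa a1 a2; have [a10 a11 a20 a21] := pos Sa a1 a2; have [t0 t1] := (th0, th1).
    rewrite ler_pdivlMr// (mulrC a.2).
    have : 0 <= (1 - th) * a.1 by rewrite mulr_ge0 ?ltW.
    have : 0 <= (1 - th) * a.2 by rewrite mulr_ge0 ?ltW.
    have : (1 - th) * a.1 <= 1 - th by rewrite ler_piMr// ltW.
    by move=> h1 h2 h3; split=> -[/andP[_ ?] /andP[_ ?]]; split; apply/andP; split=> //; lra.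
  - move=> a Sa a1 a2; have [a10 a11 a20 a21] := pos Sa a1 a2; have [t0 t1] := (th0, th1).
    have : 0 < th * a.2 by rewrite mulr_gt0.
    by move=> h1; split=> [[_ /andP[_ ?]]|[_ /andP[_ ?]]]; lra.
rewrite (@prob_upper_left _ _ 1 ((y - (1 - th)) / th)) ?(@prob_lower_right _ _ 1 1).
- rewrite !cdf2_1y ?ler01 ?lexx//; first by field; rewrite gt_eqF.
  rewrite divr_ge0 ?(ltW th0) ?subr_ge0 ?(ltW thy)//= ler_pdivrMr// mul1r; lra.
- move=> a Sa a1 a2; have [a10 a11 a20 a21] := pos Sa a1 a2; have [t0 t1] := (th0, th1).
  have : 0 <= (1 - th) * a.1 by rewrite mulr_ge0 ?ltW.
  have : 0 <= (1 - th) * a.2 by rewrite mulr_ge0 ?ltW.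
  have : (1 - th) * a.2 <= 1 - th by rewrite ler_piMr// ltW.
  have : (1 - th) * a.1 <= 1 - th by rewrite ler_piMr// ltW.
  by move=> h1 h2 h3 h4; split=> -[/andP[_ ?] /andP[_ ?]]; split; apply/andP; split=> //; lra.
- move=> a Sa a1 a2; have [a10 a11 a20 a21] := pos Sa a1 a2; have [t0 t1] := (th0, th1).
  rewrite ler_pdivlMr// (mulrC a.2) lerBrDl.
  have : 0 <= th * a.1 by rewrite mulr_ge0 ?ltW.
  have : 0 <= th * a.2 by rewrite mulr_ge0 ?ltW.
  have : th * a.1 <= th by rewrite ler_piMr// ltW.
  by move=> h1 h2 h3; split=> -[/andP[_ ?] /andP[_ ?]]; split; apply/andP; split=> //; lra.
Qed.

End SkewSum.

Section SkewRealizable.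
Variable R : realType.
Implicit Types (f : plane R -> R).

Lemma upper_left_unit_square (th : R) z : 0 < th < 1 ->
  unit_square z -> unit_square (upper_left th z).
Proof.
move=> /andP[th0 th1] /unit_squareP[/andP[x0 x1] /andP[y0 y1]].
have h1 : 0 <= th * z.1 by rewrite mulr_ge0 ?(ltW th0).
have h2 : th * z.1 <= th by rewrite ler_piMr// ltW.
have h3 : 0 <= th * z.2 by rewrite mulr_ge0 ?(ltW th0).
have h4 : th * z.2 <= th by rewrite ler_piMr// ltW.
by split; rewrite /= in_itv/=; lra.
Qed.

Lemma lower_right_unit_square (th : R) z : 0 < th < 1 ->
  unit_square z -> unit_square (lower_right th z).
Proof.
move=> /andP[th0 th1] /unit_squareP[/andP[x0 x1] /andP[y0 y1]].
have t1 : 0 < 1 - th by lra.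
have h1 : 0 <= (1 - th) * z.1 by rewrite mulr_ge0 ?(ltW t1).
have h2 : (1 - th) * z.1 <= 1 - th by rewrite ler_piMr// ltW.
have h3 : 0 <= (1 - th) * z.2 by rewrite mulr_ge0 ?(ltW t1).
have h4 : (1 - th) * z.2 <= 1 - th by rewrite ler_piMr// ltW.
by split; rewrite /= in_itv/=; lra.
Qed.

Lemma integral_distribution_unit mu (X : {mfun (plane R) >-> (plane R)}) f :
  uniform_margins mu -> (forall z, unit_square z -> unit_square (X z)) -> unit_valued f ->
  (\int[distribution mu X]_(z in unit_square) (f z)%:E = (mean mu (f \o X))%:E)%E.
Proof.
move=> unif XS [mf f01]; have mS := @measurable_unit_square R.
have mX : measurable_fun setT X by [].
rewrite ge0_integral_pushforward//; last 2 first.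
- by apply/measurable_EFinP; exact: measurable_funTS.
- by move=> z /set_mem/f01/andP[]; rewrite lee_fin.
rewrite (@integral_unit_square _ mu _ (f \o X))//; last 3 first.
- exact: measurable_preimage.
- by apply: measurable_funTS; exact: measurableT_comp.
- by move=> z /f01/andP[].
rewrite mean_fineK//; last by move=> z /XS/f01.
exact: measurableT_comp.
Qed.

Section SkewSumMoments.
Variables (th : R) (th01 : 0 < th < 1) (mu1 mu2 : probability (plane R) R).
Hypothesis unif1 : uniform_margins mu1.
Hypothesis unif2 : uniform_margins mu2.

Lemma mean_skew_sum f : unit_valued f -> mean (skew_sum th01 mu1 mu2) f =
  th * mean mu1 (f \o upper_left th) + (1 - th) * mean mu2 (f \o lower_right th).
Proof.
move=> uf; have [mf f01] := uf; have mS := @measurable_unit_square R.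
have mfE : measurable_fun unit_square (fun z => (f z)%:E).
  by apply/measurable_EFinP; exact: measurable_funTS.
have f0 z : unit_square z -> (0 <= (f z)%:E)%E by move=> /f01/andP[]; rewrite lee_fin.
apply: EFin_inj; rewrite mean_fineK// ge0_integral_measure_add//.
rewrite !ge0_integral_mscale// !integral_distribution_unit//.
- by move=> z; exact: lower_right_unit_square.
- by move=> z; exact: upper_left_unit_square.
Qed.

(** A pair can be concordant only inside one block, and the blocks contain a pair with probabilities
    [th^2] and [(1 - th)^2]. *)
Lemma concordance_skew_sum : concordance (skew_sum th01 mu1 mu2) =
  th ^+ 2 * concordance mu1 + (1 - th) ^+ 2 * concordance mu2.
Proof.
have zero (mu : probability (plane R) R) c : uniform_margins mu ->
    mean mu (fun z => c * cdf2 mu z.1 z.2) = c * mean mu (fun z => cdf2 mu z.1 z.2).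
  move=> unif; rewrite -[RHS]addr0 -(mul0r (mean mu fst)).
  rewrite -(mean_affine _ _ _ (unit_valued_cdf2 unif) (unit_valued_fst R)).
  by apply: eq_mean => z _; rewrite mul0r addr0.
have unif := uniform_margins_skew_sum th01 unif1 unif2.
rewrite /concordance mean_skew_sum; last exact: unit_valued_cdf2.
rewrite (@eq_mean _ mu1 _ (fun z => th * cdf2 mu1 z.1 z.2)); last first.
  by move=> z Sz /=; rewrite cdf2_skew_upper_left.
rewrite (@eq_mean _ mu2 _ (fun z => (1 - th) * cdf2 mu2 z.1 z.2)); last first.
  by move=> z Sz /=; rewrite cdf2_skew_lower_right.
by rewrite !zero//; ring.
Qed.

(** The translations contribute linear terms with mean 1/2, which yield exactly the mixed terms of
    [(th + (1 - th))^3 = 1]. With the normalisation [6 m - 1] only the cubes survive. *)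
Lemma rescaled_rho_skew_sum : rescaled_rho (skew_sum th01 mu1 mu2) =
  th ^+ 3 * rescaled_rho mu1 + (1 - th) ^+ 3 * rescaled_rho mu2.
Proof.
rewrite /rescaled_rho mean_skew_sum; last exact: unit_valued_prod.
rewrite (@eq_mean _ mu1 _ (fun z => th * (1 - th) * z.1 + th ^+ 2 * (z.1 * z.2))); last first.
  by move=> z _ /=; ring.
rewrite (@eq_mean _ mu2 _ (fun z => th * (1 - th) * z.2 + (1 - th) ^+ 2 * (z.1 * z.2))); last first.
  by move=> z _ /=; ring.
rewrite (mean_affine _ _ _ (unit_valued_fst R) (unit_valued_prod R)).
rewrite (mean_affine _ _ _ (unit_valued_snd R) (unit_valued_prod R)).
by rewrite mean_fst// mean_snd//; field.
Qed.

End SkewSumMoments.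

Lemma realizable_skew (th p1 r1 p2 r2 : R) : 0 <= th <= 1 ->
  realizable p1 r1 -> realizable p2 r2 ->
  realizable (th ^+ 2 * p1 + (1 - th) ^+ 2 * p2) (th ^+ 3 * r1 + (1 - th) ^+ 3 * r2).
Proof.
move=> /andP[]; rewrite le_eqVlt => /predU1P[<- _ _|th0].
  by rewrite !expr0n /= !mul0r !add0r subr0 !expr1n !mul1r.
rewrite le_eqVlt => /predU1P[->|th1].
  by rewrite subrr !expr0n /= !mul0r !addr0 !expr1n !mul1r.
have th01 : 0 < th < 1 by rewrite th0.
move=> [mu1 [unif1 <- <-]] [mu2 [unif2 <- <-]].
exists (skew_sum th01 mu1 mu2); split.
- exact: uniform_margins_skew_sum.
- exact: concordance_skew_sum.
- exact: rescaled_rho_skew_sum.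
Qed.

Definition diag (x : measurableTypeR R) : plane R := (x, x).

Lemma measurable_diag : measurable_fun setT diag.
Proof. by apply: measurable_fun_pair; exact: measurable_id. Qed.

HB.instance Definition _ := isMeasurableFun.Build _ _ _ _ diag measurable_diag.

Definition comonotone : probability (plane R) R :=
  distribution (uniform_prob (@ltr01 R)) diag.

Lemma cdf2_comonotone x y : 0 <= x <= 1 -> 0 <= y <= 1 ->
  cdf2 comonotone x y = Num.min x y.
Proof.
move=> /andP[x0 x1] /andP[y0 y1].
have m0 : 0 <= Num.min x y by rewrite le_min x0.
have m1 : Num.min x y <= 1 by rewrite ge_min x1.
have -> : cdf2 comonotone x y = fine (uniform_prob (@ltr01 R) (`[0, Num.min x y]%classic)).
  rewrite /cdf2 /comonotone /= /distribution /pushforward; congr (fine (uniform_prob _ _)).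
  apply/seteqP; split=> t [/=]; rewrite ?in_itv/= ?le_min.
    by move=> /andP[-> ->] /andP[_ ->].
  by move=> /andP[t0 /andP[tx ty]]; split; rewrite /= in_itv/= t0.
rewrite /uniform_prob integral_uniform_pdf setIidl; last first.
  by move=> t /=; rewrite !in_itv/= => /andP[-> /le_trans]; apply.
rewrite (eq_integral (cst 1%E)); last first.
  move=> t; rewrite inE/= in_itv/= => /andP[t0 tm].
  by rewrite /uniform_pdf t0 (le_trans tm)//= subr0 invr1.
rewrite integral_cst// mul1e.
rewrite [X in fine X](@lebesgue_measure_itv R `[0, Num.min x y])/= lte_fin.
have [_|m_le0] := ltP 0 (Num.min x y); first by rewrite /= ?oppr0 ?addr0 ?subr0.
by apply/le_anti; rewrite m0 m_le0.
Qed.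

Lemma uniform_margins_comonotone : uniform_margins comonotone.
Proof.
have i1 : 0 <= (1 : R) <= 1 by rewrite ler01 lexx.
split=> z z01; rewrite cdf2_comonotone//; case/andP: z01 => z0 z1.
  by apply/min_idPl.
by apply/min_idPr.
Qed.

(* rescaled_rho is not integrated: it lies between the lower bound for k = 1 and
   the same bound after reflection. *)
Lemma realizable11 : realizable (1 : R) 1.
Proof.
have unif := uniform_margins_comonotone; exists comonotone.
have c1 : concordance comonotone = 1.
  suff e : mean comonotone (fun z => cdf2 comonotone z.1 z.2) = mean comonotone fst.
    by rewrite /concordance e mean_fst//; field.
  apply: EFin_inj; have uF := unit_valued_cdf2 unif.
  have [mF F01] := uF; have [mf f01] := unit_valued_fst R.
  rewrite !mean_fineK//; have mS := @measurable_unit_square R.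
  have m1 (f : plane R -> R) : measurable_fun setT f ->
      measurable_fun unit_square (fun z => (f z)%:E : \bar R).
    by move=> m; apply/measurable_EFinP; exact: measurable_funTS.
  rewrite !ge0_integral_pushforward//; try exact: m1.
  - apply: eq_integral => t; rewrite inE => -[/= t01 _]; congr EFin.
    by rewrite /= cdf2_comonotone ?minxx; move: t01; rewrite in_itv.
  - by move=> z /set_mem/f01/andP[]; rewrite lee_fin.
  - by move=> z /set_mem/F01/andP[]; rewrite lee_fin.
have real : realizable (concordance comonotone) (rescaled_rho comonotone) by exists comonotone.
split=> //; have [_ /andP[_ r1] /(_ 1 isT)] := realizable_bounds real.
rewrite c1 invf_lt1 ?ltr0n// (ltr_nat R 1) => /(_ isT) h.
apply/le_anti; rewrite r1 (le_trans _ h)// /part_cubes subrr mulr0 mul0r subr0.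
rewrite part_gap_sqr// ?invf_le1 ?(ler_nat R 1)//.
rewrite (_ : 1 + _ = 2 ^+ 2) ?divff//.
by field.
Qed.

Lemma realizable00 : realizable (0 : R) 0.
Proof. by have := realizable_reflect realizable11; rewrite subrr. Qed.

(** A skew sum of comonotone blocks of lengths [s] in a square of side [m], the remaining length
    being filled by the countermonotone copula of [realizable00]. Each step splits off the first
    block with [th = x / m]. *)
Lemma realizable_blocks_scaled (s : seq R) (m : R) : all (>= 0) s -> 0 < m ->
  \sum_(x <- s) x <= m ->
  realizable ((\sum_(x <- s) x ^+ 2) / m ^+ 2) ((\sum_(x <- s) x ^+ 3) / m ^+ 3).
Proof.
elim: s m => [|x s IH] m; first by rewrite !big_nil !mul0r => *; exact: realizable00.
rewrite /= => /andP[x0 s0] m0; rewrite !big_cons => xsm.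
have S0 : 0 <= \sum_(y <- s) y by rewrite big_seq sumr_ge0// => y /(allP s0).
have xm : x <= m by rewrite (le_trans _ xsm)// lerDl.
pose th := x / m; have th01 : 0 <= th <= 1.
  by rewrite divr_ge0 ?(ltW m0)//= ler_pdivrMr// mul1r.
move: xm; rewrite le_eqVlt => /predU1P[xm|xm].
  have s00 : forall y, y \in s -> y = 0.
    move=> y ys; have Sle : \sum_(y <- s) y <= 0 by lra.
    have y0 : 0 <= y := allP s0 y ys.
    apply/le_anti; rewrite y0 andbT (le_trans _ Sle)//.
    rewrite (big_rem y)//= lerDl big_seq sumr_ge0// => z /mem_rem; exact: (allP s0).
  have sX n : \sum_(y <- s) y ^+ n.+1 = 0.
    by rewrite big_seq big1// => y /s00 ->; rewrite expr0n.
  rewrite !sX !addr0 xm !divff ?expf_neq0 ?gt_eqF//; exact: realizable11.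
have mx : 0 < m - x by rewrite subr_gt0.
have := realizable_skew th01 realizable11 (IH (m - x) s0 mx _).
rewrite lerBrDl => /(_ xsm).
rewrite (_ : 1 - th = (m - x) / m); last by rewrite /th; field; rewrite gt_eqF.
move: (\sum_(y <- s) y ^+ 2) (\sum_(y <- s) y ^+ 3) => P2 P3.
rewrite (_ : th ^+ 2 * 1 + _ = (x ^+ 2 + P2) / m ^+ 2); last first.
  by rewrite /th; field; rewrite !gt_eqF.
rewrite (_ : th ^+ 3 * 1 + _ = (x ^+ 3 + P3) / m ^+ 3)//.
by rewrite /th; field; rewrite !gt_eqF.
Qed.

Lemma realizable_blocks (s : seq R) : all (>= 0) s -> \sum_(x <- s) x <= 1 ->
  realizable (\sum_(x <- s) x ^+ 2) (\sum_(x <- s) x ^+ 3).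
Proof.
move=> s0 s1; have := realizable_blocks_scaled s0 ltr01 s1.
by rewrite !expr1n !divr1.
Qed.

End SkewRealizable.

(** * Filling the region between the boundaries *)

Section Filling.
Variable R : realType.
Implicit Types (p r : R).

Lemma continuous_cube (f : R -> R) : continuous f -> continuous (fun x => f x ^+ 3).
Proof.
by move=> fc x; apply: (@continuous_comp _ _ _ f (fun y => y ^+ 3)); [exact: fc|exact: exprn_continuous].
Qed.

Lemma continuous_quadratic_sqrt (a b : R) : continuous (fun x : R => Num.sqrt (a * x ^+ 2 + b)).
Proof.
move=> x; apply: (@continuous_comp _ _ _ (fun x : R => a * x ^+ 2 + b) Num.sqrt).
  apply: cvgD; last exact: cvg_cst.
  by apply: cvgMl_tmp; exact: exprn_continuous.
exact: sqrt_continuous.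
Qed.

Lemma continuous_IVT (f : R -> R) (a b v : R) : a <= b -> continuous f ->
  Num.min (f a) (f b) <= v <= Num.max (f a) (f b) -> exists2 c, a <= c <= b & f c = v.
Proof.
move=> ab fc h; have [c + <-] := IVT ab (continuous_subspaceT fc) h.
by rewrite in_itv /=; exists c.
Qed.

(* The blocks c al, ..., c al, c be and a first block u1(c) making the sum of
   squares constant interpolate between the extremal blocks (c = 1) and a
   single block (c = 0). *)
Lemma realizable_low p r k : (0 < k)%N -> k.+1%:R^-1 < p -> p <= k%:R^-1 ->
  part_cubes k p <= r -> r <= Num.sqrt p ^+ 3 -> realizable p r.
Proof.
case: k => // k _ kp pk r1 r2; pose K := k.+1.
have p0 : 0 < p by rewrite (lt_trans _ kp)// invr_gt0.
have q0 := sqrtr_ge0 ((K.+1%:R * p - 1) / K%:R); rewrite -/(part_gap K p) in q0.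
have q1 : part_gap K p <= K%:R^-1 by exact: part_gap_le.
pose al := large_part K p; pose be := small_part K p.
have K0 : 0 < K%:R :> R by rewrite ltr0n.
have K1 : 0 < K.+1%:R :> R by rewrite ltr0n.
have be0 : 0 <= be.
  rewrite divr_ge0 ?(ltW K1)// subr_ge0 mulrC -ler_pdivlMr//.
  by rewrite div1r.
have ba : be <= al.
  rewrite ler_pM2r ?invr_gt0// lerD2l.
  by have := mulr_ge0 (ltW K0) q0; lra.
have al0 : 0 <= al := le_trans be0 ba.
have s1 : K%:R * al + be = 1 := sum_parts K p.
have s2 : K%:R * al ^+ 2 + be ^+ 2 = p := sum_parts2 (ltn0Sn k) (ltW kp).
have s3 : K%:R * al ^+ 3 + be ^+ 3 = part_cubes K p := sum_parts3 K p.
have kS : K%:R = k%:R + 1 :> R by rewrite /K natr1.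
have k0 : 0 <= k%:R :> R by [].
pose u c := Num.sqrt (- (p - al ^+ 2) * c ^+ 2 + p).
pose phi c := u c ^+ 3 + (part_cubes K p - al ^+ 3) * c ^+ 3.
have pal : 0 <= p - al ^+ 2.
  rewrite -s2 kS [leRHS](_ : _ = k%:R * al ^+ 2 + be ^+ 2); last by ring.
  by rewrite addr_ge0 ?sqr_ge0// mulr_ge0 ?sqr_ge0.
have alp : p <= al.
  rewrite -[leRHS]mulr1 -s1 -s2 -subr_ge0.
  rewrite [leRHS](_ : _ = be * (al - be)); last by ring.
  by rewrite mulr_ge0// subr_ge0.
have p1 : p <= 1 by rewrite (le_trans pk)// invf_le1// (ler_nat R 1).
have uc : continuous phi.
  move=> c; apply: cvgD; first by apply: continuous_cube; exact: continuous_quadratic_sqrt.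
  by apply: cvgMl_tmp; exact: exprn_continuous.
have phi0 : phi 0 = Num.sqrt p ^+ 3.
  by rewrite /phi /u !expr0n/= !mulr0 add0r addr0.
have phi1 : phi 1 = part_cubes K p.
  rewrite /phi /u !expr1n !mulr1 (_ : - _ + p = al ^+ 2); last by ring.
  by rewrite sqrtr_sqr ger0_norm//; ring.
have [c /andP[c0 c1] <-] : exists2 c, 0 <= c <= 1 & phi c = r.
  by apply: continuous_IVT => //; rewrite phi0 phi1 ge_min le_max r1 r2 !orbT.
have cc : 0 <= c ^+ 2 <= 1 by rewrite sqr_ge0 exprn_ile1.
have /andP[cc0 cc1] := cc.
have u2 : u c ^+ 2 = - (p - al ^+ 2) * c ^+ 2 + p.
  rewrite sqr_sqrtr// mulNr addrC subr_ge0 (@le_trans _ _ (p - al ^+ 2))//.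
    by rewrite ler_piMr.
  by rewrite gerBl sqr_ge0.
have sumc n : \sum_(x <- u c :: rcons (nseq k (c * al)) (c * be)) x ^+ n =
    u c ^+ n + (k%:R * (c * al) ^+ n + (c * be) ^+ n).
  rewrite big_cons -cats1 big_cat big_seq1 big_nseq.
  by congr (_ + (_ + _)); elim: (k) => [|j IH]; rewrite ?mul0r//= IH -natr1; ring.
have := @realizable_blocks R (u c :: rcons (nseq k (c * al)) (c * be)).
rewrite !sumc.
have -> : u c ^+ 2 + (k%:R * (c * al) ^+ 2 + (c * be) ^+ 2) = p.
  by rewrite u2 -{2}s2 -s2 kS; ring.
have -> : u c ^+ 3 + (k%:R * (c * al) ^+ 3 + (c * be) ^+ 3) = phi c.
  by rewrite /phi -s3 kS; ring.
apply.
  rewrite /= sqrtr_ge0 /= all_rcons mulr_ge0//= all_nseq mulr_ge0 ?orbT//.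
have := sumc 1; under eq_bigr => x _ do rewrite expr1.
move=> ->; rewrite !expr1.
have -> : k%:R * (c * al) + c * be = c * (1 - al) by rewrite -[in RHS]s1 kS; ring.
(* The blocks fit when [u c <= 1 - c (1 - al)]. The difference of the squares has the factor
   [1 - c], and the cofactor is nonnegative as [p <= al] and [p <= 1]. *)
rewrite -lerBrDr -(@ler_pXn2r _ 2)// ?nnegrE ?sqrtr_ge0//; last first.
  rewrite subr_ge0 (@le_trans _ _ (1 - al))//.
    by rewrite ler_piMl// subr_ge0 -s1 kS; nra.
  by rewrite gerBl.
rewrite u2 -subr_ge0.
rewrite [leRHS](_ : _ = (1 - c) * ((1 - c) * (1 - p) + 2 * c * (al - p))); last by ring.
by rewrite mulr_ge0 ?subr_ge0// addr_ge0// mulr_ge0 ?subr_ge0// mulr_ge0.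
Qed.

(** Reflect a single block of relative size [z / th], scale it to side [th] and complete by a
    countermonotone part. With [z^2 = th^2 - p] the concordance stays [p] while [th] runs from one
    comonotone block at [sqrt p] to a full-size reflected block at 1. *)
Lemma realizable_mid p r : 0 < p -> p < 1 -> Num.sqrt p ^+ 3 <= r ->
  r <= 1 - Num.sqrt (1 - p) ^+ 3 -> realizable p r.
Proof.
move=> p0 p1 r1 r2.
pose z th := Num.sqrt (1 * th ^+ 2 + - p); pose phi th := th ^+ 3 - z th ^+ 3.
have phic : continuous phi.
  move=> th; apply: cvgB; first exact: exprn_continuous.
  by apply: continuous_cube; exact: continuous_quadratic_sqrt.
have sp1 : Num.sqrt p <= 1 by rewrite -sqrtr1 ler_wsqrtr// ltW.
have phi0 : phi (Num.sqrt p) = Num.sqrt p ^+ 3.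
  by rewrite /phi /z mul1r sqr_sqrtr ?(ltW p0)// subrr sqrtr0 expr0n subr0.
have phi1 : phi 1 = 1 - Num.sqrt (1 - p) ^+ 3 by rewrite /phi /z mul1r !expr1n.
have [th /andP[th0 th1] <-] : exists2 th, Num.sqrt p <= th <= 1 & phi th = r.
  by apply: continuous_IVT => //; rewrite phi0 phi1 ge_min le_max r1 r2 !orbT.
have th_gt0 : 0 < th by rewrite (lt_le_trans _ th0)// sqrtr_gt0.
have thp : p <= th ^+ 2.
  by rewrite -[leLHS](sqr_sqrtr (ltW p0)) lerXn2r// nnegrE ?sqrtr_ge0// ltW.
have z2 : z th ^+ 2 = th ^+ 2 - p by rewrite /z sqr_sqrtr mul1r// subr_ge0.
have z0 : 0 <= z th by exact: sqrtr_ge0.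
have zth : z th <= th.
  by rewrite -(@ler_pXn2r _ 2)// ?nnegrE ?(ltW th_gt0)// z2 gerBl ltW.
have := @realizable_blocks R [:: z th / th].
rewrite /= !big_seq1 divr_ge0 ?(ltW th_gt0)//= ler_pdivrMr// mul1r => /(_ isT zth).
move=> /realizable_reflect; have th01 : 0 <= th <= 1 by rewrite ltW.
move=> /(realizable_skew th01)/(_ (realizable00 R)).
rewrite !mulr0 !addr0.
have -> : th ^+ 2 * (1 - (z th / th) ^+ 2) = p.
  rewrite (_ : _ * _ = th ^+ 2 - z th ^+ 2); first by rewrite z2; ring.
  by field; rewrite gt_eqF.
have -> : th ^+ 3 * (1 - (z th / th) ^+ 3) = phi th by rewrite /phi; field; rewrite gt_eqF.
by [].
Qed.

(** The value of a single block and that of a reflected block cut the range of [r] in three; above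
    the second, reflection leads back to [realizable_low]. *)
Lemma realizable_between p r k l : 0 < p -> p < 1 ->
  (0 < k)%N -> k.+1%:R^-1 < p -> p <= k%:R^-1 ->
  (0 < l)%N -> l.+1%:R^-1 < 1 - p -> 1 - p <= l%:R^-1 ->
  part_cubes k p <= r -> r <= 1 - part_cubes l (1 - p) -> realizable p r.
Proof.
move=> p0 p1 k0 kp pk l0 lp pl r1 r2.
have [rA|Ar] := leP r (Num.sqrt p ^+ 3); first exact: (realizable_low k0 kp pk r1 rA).
have [rB|Br] := leP r (1 - Num.sqrt (1 - p) ^+ 3).
  exact: (realizable_mid p0 p1 (ltW Ar) rB).
rewrite -[p](subKr 1) -[r](subKr 1); apply: realizable_reflect.
by apply: (realizable_low l0 lp pl); lra.
Qed.

End Filling.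

(** * The region *)

Section TauRho.
Variable R : realType.
Implicit Types (p r x y : R).

Lemma tau_rho_realizable (z : R^o * R^o) :
  tau_rho_region R z <-> realizable ((1 + z.1) / 2) ((1 + z.2) / 2).
Proof.
split=> [[A [mu [cA Amu -> ->]]]|[mu [unif pE rE]]].
  have [unif AE] := copula_uniform_margins cA Amu.
  exists mu; split=> //; last first.
    by rewrite /rescaled_rho /spearman_rho -/(mean mu (fun z => z.1 * z.2)); field.
  rewrite /concordance /kendall_tau -/(mean mu (fun z => A z.1 z.2)).
  rewrite -(@eq_mean _ mu (fun z => A z.1 z.2)); first by field.
  by move=> t /unit_squareP[? ?]; exact: AE.
exists (cdf2 mu), mu; split.
- exact: copula_cdf2.
- exact: copula_measure_cdf2.
- rewrite /kendall_tau -/(mean mu (fun z => cdf2 mu z.1 z.2)).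
  by move: pE; rewrite /concordance; lra.
- rewrite /spearman_rho -/(mean mu (fun z => z.1 * z.2)).
  by move: rE; rewrite /rescaled_rho; lra.
Qed.

Lemma exists_scallop p : 0 < p -> p <= 1 ->
  exists k, [/\ (0 < k)%N, k.+1%:R^-1 < p & p <= k%:R^-1].
Proof.
move=> p0 p1.
have ex : exists k, k.+1%:R^-1 < p.
  exists (Num.bound p^-1); rewrite -[ltRHS]invrK ltf_pV2 ?posrE ?invr_gt0//.
  rewrite (lt_trans (archi_boundP _)) ?invr_ge0 ?(ltW p0)//.
  by rewrite ltr_nat.
case: (ex_minnP ex) => k kp kmin; case: k kp kmin => [|k] kp kmin.
  by move: kp; rewrite invr1 ltNge p1.
exists k.+1; split=> //; rewrite leNgt; apply/negP => /kmin.
by rewrite ltnn.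
Qed.

(** With [n = k + 1] the base [n - 2 + n x] of the power in [Phi_] is [2 k q^2] for the gap [q], so
    the power 3/2 becomes the cube of the gap. *)
Lemma Phi_part_cubes k x : (0 < k)%N ->
  k.+1%:R^-1 <= (1 + x) / 2 -> (1 + x) / 2 <= k%:R^-1 ->
  Phi x = - 1 + 2 * part_cubes k ((1 + x) / 2).
Proof.
move=> k0 kp pk; have kr : 0 < k%:R :> R by rewrite ltr0n.
have kS : k.+1%:R = k%:R + 1 :> R by rewrite natr1.
have K1 : 0 < k%:R + 1 :> R by lra.
have xlo : (2 - (k%:R + 1)) / (k%:R + 1) <= x.
  move: kp; rewrite kS [leLHS](_ : _ = (1 + (2 - (k%:R + 1)) / (k%:R + 1)) / 2).
    by rewrite ler_pM2r ?invr_gt0// lerD2l.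
  by field; rewrite gt_eqF.
have xhi : x <= (2 - k%:R) / k%:R.
  move: pk; rewrite [leRHS](_ : _ = (1 + (2 - k%:R) / k%:R) / 2).
    by rewrite ler_pM2r ?invr_gt0// lerD2l.
  by field; rewrite gt_eqF.
rewrite (@PhiE _ k.+1); last first.
  by split; rewrite ?ltnS// kS addrK xlo.
have qE := part_gap_sqr k0 kp; have q0 : 0 <= part_gap k ((1 + x) / 2) by exact: sqrtr_ge0.
rewrite /Phi_ /part_cubes; set q := part_gap _ _ in qE q0 *.
rewrite kS in qE *; rewrite addrK.
have yE : k%:R + 1 - 2 + (k%:R + 1) * x = 2 * k%:R * q ^+ 2.
  by rewrite qE; field; rewrite gt_eqF.
have -> : (k%:R + 1 - 2 + (k%:R + 1) * x) `^ (3 / 2) =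
    2 * k%:R * q ^+ 3 * (Num.sqrt 2 * Num.sqrt k%:R).
  rewrite yE; have [q_eq0|q_neq0] := eqVneq q 0.
    by rewrite q_eq0 !expr0n/= !mulr0 powR0 ?mul0r//; lra.
  have y0 : 0 < 2 * k%:R * q ^+ 2.
    by rewrite mulr_gt0 ?exprn_gt0 ?mulr_gt0// lt0r q_neq0.
  rewrite (_ : 3 / 2 = 1 + 2^-1); last by field.
  rewrite powRD; last by rewrite (gt_eqF y0) implybT.
  rewrite powRr1 ?ltW// powR12_sqrt ?ltW// sqrtrM ?mulr_ge0//.
  rewrite sqrtrM// sqrtr_sqr ger0_norm//; ring.
have s2 : Num.sqrt 2 != 0 :> R by rewrite sqrtr_eq0; lra.
have sk : Num.sqrt k%:R != 0 :> R by rewrite sqrtr_eq0 -ltNge.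
have xE : x = (2 * k%:R * q ^+ 2 + 1 - k%:R) / (k%:R + 1).
  by rewrite -yE; field; rewrite gt_eqF.
rewrite xE; field; do ?[apply/andP; split] => //; by rewrite gt_eqF.
Qed.

Lemma Phi_N1 : Phi (- 1 : R) = - 1.
Proof. by rewrite /Phi eqxx. Qed.

Lemma Phi_1 : Phi (1 : R) = 1.
Proof.
have e : (1 + 1) / 2 = 1 :> R by field.
rewrite (@Phi_part_cubes 1)// ?e ?invr1// ?invf_le1// ?(ler_nat R 1)//.
rewrite /part_cubes subrr mulr0 mul0r subr0 part_gap_sqr// ?invf_le1 ?(ler_nat R 1)//.
by field.
Qed.

Lemma Phi_le p r : realizable p r -> Phi (2 * p - 1) <= 2 * r - 1.
Proof.
move=> /realizable_bounds[/andP[p0 p1] /andP[r0 _] h].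
move: p0; rewrite le_eqVlt => /predU1P[<-|p0].
  by rewrite mulr0 add0r Phi_N1; lra.
have [k [k0 kp pk]] := exists_scallop p0 p1.
have e : (1 + (2 * p - 1)) / 2 = p by field.
rewrite (@Phi_part_cubes k) ?e ?(ltW kp)//.
by have := h k k0 kp; lra.
Qed.

Lemma tau_rho_eq_Phi_region : tau_rho_region R = Phi_region R.
Proof.
apply/seteqP; split=> [[x y] /tau_rho_realizable/= real|[x y] [/= hx hy hP]].
  have real' := realizable_reflect real.
  have [/andP[? ?] /andP[? ?] _] := realizable_bounds real.
  split; [rewrite /=; lra..|]; rewrite /=; apply/andP; split.
    have := Phi_le real.
    rewrite (_ : 2 * ((1 + x) / 2) - 1 = x); last by field.
    by rewrite (_ : 2 * ((1 + y) / 2) - 1 = y)//; field.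
  have := Phi_le real'.
  rewrite (_ : 2 * (1 - (1 + x) / 2) - 1 = - x); last by field.
  rewrite (_ : 2 * (1 - (1 + y) / 2) - 1 = - y); last by field.
  by lra.
apply/tau_rho_realizable => /=; have /andP[P1 P2] := hP.
(* At [x = -1] and [x = 1] one of the two densities is 0 and lies on no arc; there the bounds leave
   a single point. *)
have [x_eq|x1] := eqVneq x (- 1).
  have yE : y = - 1 by move: P2; rewrite x_eq opprK Phi_1; lra.
  by rewrite x_eq yE subrr mul0r; exact: realizable00.
have [x_eq|x2] := eqVneq x 1.
  have yE : y = 1 by move: P1; rewrite x_eq Phi_1; lra.
  by rewrite x_eq yE (_ : (1 + 1) / 2 = 1); [exact: realizable11|field].
have x1' : - 1 < x by rewrite lt_neqAle eq_sym x1; case/andP: hx.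
have x2' : x < 1 by rewrite lt_neqAle x2; case/andP: hx.
have p0 : 0 < (1 + x) / 2 by lra.
have p1 : (1 + x) / 2 < 1 by lra.
have q0 : 0 < 1 - (1 + x) / 2 by lra.
have q1 : 1 - (1 + x) / 2 <= 1 by lra.
have [k [k0 kp pk]] := exists_scallop p0 (ltW p1).
have [l [l0 lp pl]] := exists_scallop q0 q1.
have e : (1 + - x) / 2 = 1 - (1 + x) / 2 by field.
apply: (realizable_between p0 p1 k0 kp pk l0 lp pl).
  by move: P1; rewrite (@Phi_part_cubes k) ?(ltW kp)//; lra.
by move: P2; rewrite (@Phi_part_cubes l) ?e ?(ltW lp)//; lra.
Qed.

(* The midpoint of two consecutive corners of the lower boundary lies below
   the concave arc joining them. *)
Lemma tau_rho_not_convex : ~ @convex_set R (R^o * R^o)%type (tau_rho_region R).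
Proof.
move=> conv.
(* Three equal blocks give [p = 1/3] and [r = 1/9]; two equal blocks, below, give [p = 1/2] and
   [r = 1/4]. *)
have A1 : tau_rho_region R (- (1 / 3) : R^o, - (7 / 9) : R^o).
  apply/tau_rho_realizable => /=.
  have s0 : all (>= 0) (nseq 3 (1 / 3 : R)).
    by rewrite /= !divr_ge0.
  have s1 : \sum_(x <- nseq 3 (1 / 3 : R)) x <= 1 by rewrite !big_cons big_nil; lra.
  have := realizable_blocks s0 s1; rewrite !big_cons !big_nil.
  rewrite [X in realizable X _ -> _](_ : _ = (1 + - (1 / 3)) / 2); last by field.
  by rewrite [X in realizable _ X -> _](_ : _ = (1 + - (7 / 9)) / 2)//; field.
have A2 : tau_rho_region R (0 : R^o, - (1 / 2) : R^o).
  apply/tau_rho_realizable => /=.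
  have s0 : all (>= 0) (nseq 2 (1 / 2 : R)).
    by rewrite /= !divr_ge0.
  have s1 : \sum_(x <- nseq 2 (1 / 2 : R)) x <= 1 by rewrite !big_cons big_nil; lra.
  have := realizable_blocks s0 s1; rewrite !big_cons !big_nil.
  rewrite [X in realizable X _ -> _](_ : _ = (1 + 0) / 2); last by field.
  by rewrite [X in realizable _ X -> _](_ : _ = (1 + - (1 / 2)) / 2)//; field.
have h0 : 0 <= 1 / 2 :> R by lra.
have h1 : 1 / 2 <= 1 :> R by lra.
pose t : {i01 R} := Itv01 h0 h1.
have := conv _ _ t (mem_set A1) (mem_set A2) => /set_mem/tau_rho_realizable.
rewrite [X in realizable ((1 + X) / 2) _](_ : _ =
  1 / 2 * (- (1 / 3)) + (1 - 1 / 2) * 0)//.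
rewrite [X in realizable _ ((1 + X) / 2)](_ : _ =
  1 / 2 * (- (7 / 9)) + (1 - 1 / 2) * (- (1 / 2)))//.
rewrite (_ : (1 + (1 / 2 * _ + _ * 0)) / 2 = 5 / 12); last by field.
rewrite (_ : (1 + _) / 2 = 13 / 72); last by field.
move=> /realizable_bounds[_ _ /(_ 2 isT)].
have lo : 3^-1 < 5 / 12 :> R by lra.
move=> /(_ lo); rewrite /part_cubes.
have q0 : 0 <= part_gap 2 (5 / 12 : R) by exact: sqrtr_ge0.
have := @part_gap_sqr R 2 (5 / 12) isT (ltW lo).
move: (part_gap 2 (5 / 12 : R)) q0 => q q0 q2.
have {}q2 : q ^+ 2 = 1 / 8 by rewrite q2; field.
(* At the midpoint the bound would force [q >= 1/2], whereas [q^2 = 1/8]. *)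
rewrite ler_pdivrMr ?exprn_gt0// (exprS q 2) q2; nra.
Qed.

End TauRho.

Theorem theorem5p1 (R : realType) :
  tau_rho_region R = Phi_region R /\
  ~ @convex_set R (R^o * R^o)%type (tau_rho_region R).
Proof. by split; [exact: tau_rho_eq_Phi_region|exact: tau_rho_not_convex]. Qed.
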